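(* Let $A$ be a real isotropic $d\times d$ dilation matrix, let $m\ge1$, let $\phi^m$ be the corresponding elliptic scaling function of order $m$, and let $\Delta^\sharp$ be the operator with symbol $\widehat{\Delta^\sharp}(\xi)=P(\xi)/M(\xi)$. Then $\phi^m$ is a linear combination of shifted versions of the Green function $\rho$ of $(\Delta^\sharp)^m$, whose Fourier transform is $$\hat\rho(\xi)=\left(\frac{M(\xi)}{P(\xi)}\right)^m;$$ that is, in the Fourier domain $\hat\phi^m$ is the product of a trigonometric polynomial and $\hat\rho$. Moreover, $$(\Delta^\sharp)^m\phi^m(x)=0\qquad\text{for all }x\in\mathbb{R}^d\setminus\mathbb{Z}^d$$ (i.e. the distribution $(\Delta^\sharp)^m\phi^m$ vanishes on the open set $\mathbb{R}^d\setminus\mathbb{Z}^d$).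
   Context: A real isotropic dilation matrix is a $d\times d$ matrix $A$ with integer entries, all of whose eigenvalues are greater than $1$ in absolute value, which is diagonalizable over $\mathbb{C}$ and all of whose eigenvalues have equal absolute value. Put $q:=|\det A|$ and $A^{-T}:=(A^T)^{-1}$. One can factor $A^{-T}=q^{-1/d}Q^{-1}UQ$ with $U$ real orthogonal and $Q$ real symmetric positive definite; fix such a $Q$ and write $Q^2=(q_{ij})_{1\le i,j\le d}$. Define $$P(\xi):=\xi^TQ^2\xi=\sum_{i} q_{ii}\xi_i^2+2\sum_{i<j}q_{ij}\xi_i\xi_j,\qquad G(\xi):=4\sum_{i} q_{ii}\sin^2\frac{\xi_i}{2}+2\sum_{i<j}q_{ij}\sin\xi_i\sin\xi_j .$$ Let $S(A^T):=\{s\in[0,1)^d: A^Ts\in\mathbb{Z}^d\}$ (this set has $q$ elements and contains $0$), and define the mask $$m_0(\xi):=\prod_{s\in S(A^T)\setminus\{0\}}\frac{G(\xi+2\pi s)}{G(2\pi s)}.$$ Define $$\mu(\xi):=\frac{q^{2/d}\,m_0(A^{-T}\xi)\,G(A^{-T}\xi)}{G(\xi)},$$ where at the points of $2\pi\mathbb{Z}^d$ (zeros of $G$) the value is understood as the limit, and $M(\xi):=\prod_{j=0}^\infty\mu\bigl((A^{-T})^j\xi\bigr)$ (a positive continuous function). The elliptic scaling function $\phi$ is the tempered distribution with $\hat\phi(\xi)=\prod_{j=1}^\infty m_0((A^{-T})^j\xi)=\frac{G(\xi)}{P(\xi)}M(\xi)$ (with $G/P:=1$ at $\xi=0$); it is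 compactly supported. The elliptic scaling function of order $m$ is $\phi^1:=\phi$, $\phi^m:=\phi*\phi^{m-1}$, i.e. $\hat\phi^m(\xi)=(\hat\phi(\xi))^m$. The Fourier transform is $\hat f(\xi)=\int_{\mathbb{R}^d} f(x)e^{-i\xi\cdot x}\,dx$. The operator with symbol $\sigma$ acts by multiplication in the Fourier domain: $f\mapsto$ the distribution with Fourier transform $\sigma\hat f$. The Green function $\rho$ of $(\Delta^\sharp)^m$ is characterized in the Fourier domain by $(\widehat{\Delta^\sharp}(\xi))^m\hat\rho(\xi)\equiv1$, i.e. $(\Delta^\sharp)^m\rho=\delta$; identities involving $\hat\rho$ are understood for $\xi\ne0$. A trigonometric polynomial is a finite sum $\sum_{k\in\mathbb{Z}^d}c_ke^{ik\cdot\xi}$; multiplication by $e^{-ik\cdot\xi}$ in the Fourier domain corresponds to the shift by $k$. *)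

(* Defs.v *)
From HB Require Import structures.
From mathcomp Require Import all_boot all_order all_algebra.
From mathcomp Require Import complex.
From mathcomp Require Import all_classical all_reals all_analysis.

Set Implicit Arguments.
Unset Strict Implicit.
Unset Printing Implicit Defensive.

Import Order.TTheory GRing.Theory Num.Theory.
Import numFieldNormedType.Exports.

Local Open Scope classical_set_scope.
Local Open Scope complex_scope.
Local Open Scope ring_scope.

(* Points of R^d are column vectors. *)

Section Dilation.
Context {R : realType} {d : nat}.
Implicit Types (A : 'M[int]_d) (Q : 'M[R]_d) (xi : 'cV[R]_d).

Definition isotropic_dilation A : Prop :=
  let AC : 'M[R[i]]_d := map_mx intr A in
  [/\ forall a : R[i], eigenvalue AC a -> 1 < `|a|,
      diagonalizable AC
    & forall a b : R[i], eigenvalue AC a -> eigenvalue AC b -> `|a| = `|b|].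

Definition matrix_over_R A : 'M[R]_d := map_mx intr A.

Definition dilation_index A : nat := `|\det A|%N.

(* A^{-T} *)
Definition inv_tr A : 'M[R]_d := invmx (matrix_over_R A)^T.

Definition sym_posdef Q : Prop :=
  Q^T = Q /\ forall x : 'cV[R]_d, x != 0 -> 0 < (x^T *m Q *m x) 0 0.

Definition orthogonal_mx (U : 'M[R]_d) : Prop := U^T *m U = 1%:M.

Definition factors A Q : Prop :=
  sym_posdef Q /\
  exists2 U : 'M[R]_d, orthogonal_mx U
    & inv_tr A =
      ((dilation_index A)%:R `^ (- d%:R^-1)) *: (invmx Q *m U *m Q).

Definition polP Q xi : R := (xi^T *m (Q *m Q) *m xi) 0 0.

Definition trigG Q xi : R :=
  4 * (\sum_(i < d) (Q *m Q) i i * sin (xi i 0 / 2) ^+ 2)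
  + 2 * (\sum_(i < d) \sum_(j < d | (i < j)%N)
           (Q *m Q) i j * sin (xi i 0) * sin (xi j 0)).

Definition int_lattice : set 'cV[R]_d := range (map_mx intr : 'cV[int]_d -> _).

Definition digits A : set 'cV[R]_d :=
  [set s : 'cV[R]_d | (forall i, 0 <= s i 0 < 1) /\
    int_lattice ((matrix_over_R A)^T *m s)].

(* The index set is finite, so this finitely supported product is the product
   over all of it. *)
Definition elliptic_mask A Q xi : R :=
  \big[*%R/1]_(s \in digits A `\ 0)
    (trigG Q (xi + (2 * pi) *: s) / trigG Q ((2 * pi) *: s)).

Definition mu_quot A Q xi : R :=
  (dilation_index A)%:R `^ (2 / d%:R)
  * elliptic_mask A Q (inv_tr A *m xi) * trigG Q (inv_tr A *m xi) / trigG Q xi.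

(* The zero set of trigG is 2 pi Z^d. *)
Definition mu A Q xi : R :=
  if trigG Q xi == 0 then lim (mu_quot A Q eta @[eta --> xi^'])
  else mu_quot A Q xi.

Definition prodM A Q xi : R :=
  lim ((\prod_(j < n) mu A Q (iter j (mulmx (inv_tr A)) xi)) @[n --> \oo]).

Definition phi_hat A Q xi : R :=
  lim ((\prod_(1 <= j < n.+1) elliptic_mask A Q (iter j (mulmx (inv_tr A)) xi))
       @[n --> \oo]).

Definition laplacian_symbol A Q xi : R := polP Q xi / prodM A Q xi.

End Dilation.

Section Distributions.
Context {R : realType}.

(* The Lebesgue integral over R^d, as an iterated integral in the coordinates;
   for an integrable f the two agree by Fubini. *)
Fixpoint integral_Rd (d : nat) : ('cV[R]_d -> R) -> R :=
  match d return ('cV[R]_d -> R) -> R with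
  | 0 => fun f => f 0
  | d'.+1 => fun f =>
      \int[lebesgue_measure]_x
        integral_Rd (fun y : 'cV[R]_d' => f (col_mx (x%:M : 'cV[R]_1) y))
  end.

Context {d : nat}.
Implicit Types (f g : 'cV[R]_d -> R[i]) (x xi : 'cV[R]_d).

Definition cintegral f : R[i] :=
  integral_Rd (fun x => complex.Re (f x))
  +i* integral_Rd (fun x => complex.Im (f x)).

Definition dot x xi : R := \sum_(i < d) x i 0 * xi i 0.

(* e^{it} *)
Definition cis (t : R) : R[i] := cos t +i* sin t.

Definition fourier f xi : R[i] := cintegral (fun x => f x * cis (- dot xi x)).

Definition partial (i : 'I_d) (u : 'cV[R]_d -> R) : 'cV[R]_d -> R :=
  fun x => 'D_(delta_mx i 0 : 'cV[R]_d) u x.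

(* The sequence s lists the variables of differentiation with multiplicity. *)
Definition partials (s : seq 'I_d) (u : 'cV[R]_d -> R) : 'cV[R]_d -> R :=
  foldr partial u s.

Definition smooth_real (u : 'cV[R]_d -> R) : Prop :=
  forall s : seq 'I_d, continuous (partials s u) /\
    forall i x, derivable (partials s u) x (delta_mx i 0 : 'cV[R]_d).

Definition smooth f : Prop :=
  smooth_real (fun x => complex.Re (f x)) /\
  smooth_real (fun x => complex.Im (f x)).

Definition cpartials (s : seq 'I_d) f x : R[i] :=
  partials s (fun y => complex.Re (f y)) x
  +i* partials s (fun y => complex.Im (f y)) x.

Definition weighted_partial (a s : seq 'I_d) f x : R[i] :=
  (\prod_(i <- a) x i 0)%:C * cpartials s f x.

Definition schwartz f : Prop :=
  smooth f /\
  forall a s : seq 'I_d, exists C : R,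
    forall x, `|weighted_partial a s f x| <= C%:C.

Definition compact_support_in (O : set 'cV[R]_d) f : Prop :=
  compact (closure [set x | f x != 0]) /\ closure [set x | f x != 0] `<=` O.

(* Only the values on Schwartz functions are meaningful.  In the continuity
   clause, b bounds the finitely many Schwartz seminorms of order at most N. *)
Definition tempered (T : ('cV[R]_d -> R[i]) -> R[i]) : Prop :=
  (forall (a b : R[i]) f g, schwartz f -> schwartz g ->
     T (fun x => a * f x + b * g x) = a * T f + b * T g) /\
  exists (C : R) (N : nat), forall f (b : R), schwartz f ->
    (forall a s : seq 'I_d, (size a <= N)%N -> (size s <= N)%N ->
       forall x, `|weighted_partial a s f x| <= b%:C) ->
    `|T f| <= (C * b)%:C.

(* T is a tempered distribution whose Fourier transform, defined by the duality
   <T^, psi> = <T, psi^>, is the function h. *)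
Definition has_fourier (T : ('cV[R]_d -> R[i]) -> R[i])
    (h : 'cV[R]_d -> R[i]) : Prop :=
  tempered T /\
  forall psi, schwartz psi ->
    T (fourier psi) = cintegral (fun xi => h xi * psi xi).

Definition vanishes_on (O : set 'cV[R]_d)
    (T : ('cV[R]_d -> R[i]) -> R[i]) : Prop :=
  forall psi, smooth psi -> compact_support_in O psi -> T psi = 0.

Definition trig_poly (c : seq ('cV[int]_d * R[i])) xi : R[i] :=
  \sum_(kc <- c) kc.2 * cis (dot (map_mx intr kc.1) xi).

End Distributions.

Section EllipticScaling.
Context {R : realType} {d : nat}.

Definition phi_hat_pow (A : 'M[int]_d) (Q : 'M[R]_d) (m : nat)
    (xi : 'cV[R]_d) : R[i] := (phi_hat A Q xi)%:C ^+ m.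

Definition elliptic_scaling_function (A : 'M[int]_d) (Q : 'M[R]_d) (m : nat)
    (phim : ('cV[R]_d -> R[i]) -> R[i]) : Prop :=
  has_fourier phim (phi_hat_pow A Q m).

(* g is the image of f under the operator with symbol sigma, for a distribution
   f whose Fourier transform is the function fhat. *)
Definition multiplier_image (sigma fhat : 'cV[R]_d -> R[i])
    (f g : ('cV[R]_d -> R[i]) -> R[i]) : Prop :=
  has_fourier f fhat /\ has_fourier g (fun xi => sigma xi * fhat xi).

End EllipticScaling.

(* Main.v *)
Require Import Defs.
From mathcomp Require Import all_boot all_order all_algebra.
From mathcomp Require Import complex.
From mathcomp Require Import all_classical all_reals all_analysis.
From mathcomp Require Import measurable_realfun lebesgue_integral_under.
From mathcomp Require Import ring lra zify.
Set Implicit Arguments.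
Unset Strict Implicit.
Unset Printing Implicit Defensive.
Import Order.TTheory GRing.Theory Num.Theory.
Import numFieldNormedType.Exports.
Local Open Scope classical_set_scope.
Local Open Scope complex_scope.
Local Open Scope ring_scope.

(** Write B for A^{-T}.  On the Fourier side everything is explicit: the
    refinement mask is built so that phi^ = G M / P, and then the symbol
    (P / M)^m times (phi^)^m is the trigonometric polynomial G^m.

    The identity phi^ = G M / P is a telescoping.  By definition of mu,
    q^{2/d} m_0(B xi) G(B xi) = mu(xi) G(xi) ([mask_refinement]), so multiplying
    along the orbit of xi gives
      prod_{1 <= j <= n} m_0(B^j xi) * (q^{2n/d} G(B^n xi))
        = prod_{0 <= j < n} mu(B^j xi) * G(xi)
    ([mask_prod_telescope]).  The factorization of B makes it an exact
    contraction of ratio q^{-1/d} for the norm sqrt P ([pnorm_inv_tr]), and G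
    agrees with P up to a cubic error at the origin ([trigG_sub_polP]);
    therefore q^{2n/d} G(B^n xi) tends to P(xi).  For the same two reasons
    mu(B^j xi) - 1 decays geometrically in j, so the product of the mu converges
    to a positive number M(xi) ([prodM_cvg], [phi_hatE]).

    What has to be known about mu is that it is positive everywhere, the points
    of 2 pi Z^d included.  Up to a constant, m_0 G at eta is the product of G
    over the translates of eta by 2 pi S(A^T), and translating eta by a point
    of 2 pi B Z^d permutes them modulo 2 pi Z^d ([coset_prod_periodic]).  So the
    quotient defining mu is 2 pi Z^d periodic, and its limit at every lattice
    point is the one at the origin, namely 1 ([mu_lattice]).  Elsewhere it is
    positive because G, a sum of squares ([trigG_squares]), vanishes on
    2 pi Z^d only ([trigG_eq0]).

    For the last claim, a trigonometric polynomial is the Fourier transform of a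
    combination of Dirac masses at integer points ([comb_has_fourier]), and a
    distribution with that Fourier transform is this combination, because every
    test function is the Fourier transform of a Schwartz function
    ([fourier_surj], [trig_poly_vanishes]).

    Surjectivity of the Fourier transform reduces, one coordinate at a time, to
    inversion on the line ([inversion1]).  There, transforming twice with
    opposite signs is a linear operator that commutes with multiplication by the
    variable.  Given x, subtract from u the multiple of the Gaussian that agrees
    with it at x; the difference is (t - x) v for a rapidly decreasing v
    ([rapid1_div]), so its image vanishes at x.  Hence the operator multiplies
    u(x) by the same factor as the Gaussian, which is an eigenfunction of the
    transforms because of its differential equation. *)

(** * Derivatives along affine maps *)

Lemma derivable_affine (R : numFieldType) (V W X : normedModType R)
    (u : W -> X) (q : V -> W) (x v : V) (w : W) :
  (forall h : R, q (h *: v + x) = h *: w + q x) ->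
  derivable u (q x) w -> derivable (u \o q) x v.
Proof.
move=> qE; rewrite /derivable => du.
by under eq_fun do rewrite /= qE.
Qed.

Lemma derive_affine (R : numFieldType) (V W X : normedModType R)
    (u : W -> X) (q : V -> W) (x v : V) (w : W) :
  (forall h : R, q (h *: v + x) = h *: w + q x) ->
  'D_v (u \o q) x = 'D_w u (q x).
Proof.
move=> qE; rewrite /derive.
by under eq_fun do rewrite /= qE.
Qed.

Lemma is_derive_comp_affine (R : realType) (V : normedModType R)
    (f : R -> R) (q : V -> R) (x v : V) (k df : R) :
  (forall h : R, q (h *: v + x) = h * k + q x) ->
  is_derive (q x) 1 f df -> is_derive x v (f \o q) (k * df).
Proof.
move=> qE [/derivable1_diffP dfq fE].
have dk : derivable f (q x) k by exact: diff_derivable.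
apply: DeriveDef; first exact: derivable_affine qE dk.
rewrite (derive_affine _ qE) (deriveE _ dfq) -fE (deriveE _ dfq).
by rewrite -{1}[k]mulr1 -[k * 1]/(k *: 1) linearZ.
Qed.

Lemma le_mull_bound (R : realDomainType) (a b C : R) :
  `|a| <= C -> `|b| <= 1 -> `|a * b| <= C.
Proof. by move=> aC b1; rewrite normrM (le_trans _ aC)// ler_piMr. Qed.

(** * Rapidly decreasing functions *)

Section Rapid.
Context {R : realType} {V : normedModType R} {I : Type}.
Variables (e : I -> V) (c : I -> V -> R).
Implicit Types (u v : V -> R) (K : set (V -> R)).

Definition bounded_fct u := exists C : R, forall x, `|u x| <= C.

(** One round of the conditions on Schwartz functions: [e] lists the directions
    of differentiation and [c] the coordinates to multiply by. *)
Definition step K u := bounded_fct u /\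
  forall i, [/\ forall x, derivable u x (e i), K ('D_(e i) u)
              & K (fun x => c i x * u x)].

Definition stable K := K `<=` step K.

(** The Schwartz class as a greatest fixed point: the largest class of bounded
    functions closed under partial derivatives and multiplication by coordinates.
    To show that a function is in it one exhibits a closed class, which avoids
    Leibniz formulas for mixed derivatives of products with monomials. *)
Definition rapid u := exists2 K, stable K & K u.

Lemma rapid_bounded u : rapid u -> bounded_fct u.
Proof. by case=> K sK /sK[]. Qed.

Lemma rapid_derivable u i x : rapid u -> derivable u x (e i).
Proof. by case=> K sK /sK[_ /(_ i)[]]. Qed.

Lemma rapid_derive u i : rapid u -> rapid ('D_(e i) u).
Proof. by case=> K sK Ku; exists K => //; have [_ /(_ i)[]] := sK _ Ku. Qed.

Lemma rapid_coord u i : rapid u -> rapid (fun x => c i x * u x).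
Proof. by case=> K sK Ku; exists K => //; have [_ /(_ i)[]] := sK _ Ku. Qed.

Inductive span K : set (V -> R) :=
| span_gen u of K u : span K u
| span_zero : span K (fun=> 0)
| span_lin (a : R) u v of span K u & span K v :
    span K (fun x => a * u x + v x).

Lemma bounded_lin (a : R) u v : bounded_fct u -> bounded_fct v ->
  bounded_fct (fun x => a * u x + v x).
Proof.
move=> [C uC] [D vD]; exists (`|a| * C + D) => x.
by rewrite (le_trans (ler_normD _ _))// normrM lerD// ler_wpM2l.
Qed.

Lemma derivable_lin (a : R) u v x w : derivable u x w -> derivable v x w ->
  derivable (fun y => a * u y + v y) x w.
Proof. by move=> du dv; apply: derivableD => //; exact: derivableZ. Qed.

Lemma derive_lin (a : R) u v x w : derivable u x w -> derivable v x w ->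
  'D_w (fun y => a * u y + v y) x = a * 'D_w u x + 'D_w v x.
Proof.
move=> du dv.
rewrite [LHS](@deriveD _ _ _ (fun y => a *: u y)) ?deriveZ//.
exact: derivableZ.
Qed.

Lemma step_mono K L u : K `<=` L -> step K u -> step L u.
Proof. by move=> KL [bu su]; split=> // i; have [? /KL ? /KL] := su i. Qed.

(** Boundedness, derivatives and multiplication by a coordinate are compatible
    with linear combinations, so closedness may be checked on generators. *)
Lemma step_span K L : K `<=` step (span L) -> span K `<=` step (span L).
Proof.
move=> KL w; elim => {w} [u /KL//||a u v _ [bu IHu] _ [bv IHv]].
- split; first by exists 0 => x; rewrite normr0.
  move=> i; split=> [x||]; first exact: derivable_cst.
    rewrite (_ : 'D_(e i) _ = fun=> 0); first exact: span_zero.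
    by apply/funext => x; rewrite derive_cst.
  rewrite (_ : (fun _ => _) = fun=> 0); first exact: span_zero.
  by apply/funext => x; rewrite mulr0.
- split; first exact: bounded_lin.
  move=> i; have [du su mu] := IHu i; have [dv sv mv] := IHv i.
  split=> [x||]; first exact: derivable_lin.
    rewrite (_ : 'D_(e i) _ = fun x => a * 'D_(e i) u x + 'D_(e i) v x).
      exact: span_lin.
    by apply/funext => x; rewrite derive_lin.
  rewrite (_ : (fun x => _) =
    fun x => a * (c i x * u x) + c i x * v x); first exact: span_lin.
  by apply/funext => x; ring.
Qed.

Lemma span_mono K L : K `<=` L -> span K `<=` span L.
Proof.
move=> KL u; elim => {u} [u /KL||a u v _ su _ sv]; first exact: span_gen.
  exact: span_zero.
exact: span_lin.
Qed.

Lemma rapid_step : rapid `<=` step rapid.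
Proof.
move=> u ru; split; first exact: rapid_bounded.
by move=> i; split=> [x||]; [exact: rapid_derivable|exact: rapid_derive|
  exact: rapid_coord].
Qed.

(** Coinduction up to linear combinations and up to known members of the class:
    derivatives and multiples of the generators need only be combinations of
    generators and of rapidly decreasing functions. *)
Lemma rapid_coind K : K `<=` step (span (K `|` rapid)) -> K `<=` rapid.
Proof.
move=> KP u Ku; exists (span (K `|` rapid)); last by apply: span_gen; left.
apply: step_span => v [/KP//|/rapid_step]; apply: step_mono => w rw.
by apply: span_gen; right.
Qed.

Lemma span_rapid : span rapid `<=` rapid.
Proof.
move=> u su; exists (span rapid) => //; apply: step_span => v /rapid_step.
by apply: step_mono => w; exact: span_gen.
Qed.

Lemma rapid_lin (a : R) u v : rapid u -> rapid v ->
  rapid (fun x => a * u x + v x).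
Proof.
by move=> ru rv; apply: span_rapid; apply: span_lin; exact: span_gen.
Qed.

Lemma rapid0 : rapid (fun=> 0).
Proof. by apply: span_rapid; exact: span_zero. Qed.

Lemma rapidZ (a : R) u : rapid u -> rapid (fun x => a * u x).
Proof.
move=> ru; have := rapid_lin a ru rapid0.
by under eq_fun do rewrite addr0.
Qed.

Lemma rapidD u v : rapid u -> rapid v -> rapid (fun x => u x + v x).
Proof.
move=> ru rv; have := rapid_lin 1 ru rv.
by under eq_fun do rewrite mul1r.
Qed.

Lemma rapidN u : rapid u -> rapid (fun x => - u x).
Proof.
move=> ru; have := rapidZ (-1) ru.
by under eq_fun do rewrite mulN1r.
Qed.

Lemma rapidB u v : rapid u -> rapid v -> rapid (fun x => u x - v x).
Proof. by move=> ru rv; apply: rapidD => //; exact: rapidN. Qed.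

(** Boundedness of u and of c^2 u together give an integrable bound in the
    coordinate c. *)
Lemma rapid_decay u i : rapid u ->
  exists C : R, forall x, `|u x| <= C / oneDsqr (c i x).
Proof.
move=> ru; have [C uC] := rapid_bounded ru.
have [D uD] := rapid_bounded (rapid_coord i (rapid_coord i ru)).
exists (C + D) => x; rewrite ler_pdivlMr; last first.
  by rewrite (lt_le_trans ltr01)// oneDsqr_ge1.
rewrite /oneDsqr mulrDr mulr1 lerD// (le_trans _ (uD x))//.
by rewrite mulrA normrM -expr2 (ger0_norm (sqr_ge0 _)) mulrC.
Qed.

(* A linear phase q, with slope k i in the direction e i. *)
Variables (q : V -> R) (k : I -> R).
Hypothesis qE : forall i (h : R) x, q (h *: e i + x) = h * k i + q x.

(** Differentiation exchanges u cos q and u sin q up to the constant slopes of q,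
    so the two families together are closed under it. *)
Lemma rapid_wave u : rapid u ->
  rapid (fun x => u x * cos (q x)) /\ rapid (fun x => u x * sin (q x)).
Proof.
pose K : set (V -> R) := fun w => exists2 u, rapid u &
  w = (fun x => u x * cos (q x)) \/ w = (fun x => u x * sin (q x)).
suff KP : K `<=` step (span (K `|` rapid)).
  by move=> ru; split; apply: (rapid_coind KP); exists u => //; [left|right].
have Kc u' : rapid u' -> span (K `|` rapid) (fun x => u' x * cos (q x)).
  by move=> ru; apply: span_gen; left; exists u' => //; left.
have Ks u' : rapid u' -> span (K `|` rapid) (fun x => u' x * sin (q x)).
  by move=> ru; apply: span_gen; left; exists u' => //; right.
move=> w [{}u ru wE]; have [C uC] := rapid_bounded ru.
split.
  exists C => x; case: wE => ->; apply: le_mull_bound => //.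
    by rewrite ler_norml cos_geN1 cos_le1.
  by rewrite ler_norml sin_geN1 sin_le1.
move=> i.
have du x : is_derive x (e i) u ('D_(e i) u x).
  by apply: derivableP; exact: rapid_derivable.
have dc x : is_derive x (e i) (fun x => u x * cos (q x))
    (- k i * (u x * sin (q x)) + 'D_(e i) u x * cos (q x)).
  have dq := is_derive_comp_affine (fun h => qE i h x) (is_derive_cos (q x)).
  apply: (is_derive_eq (is_deriveM (du x) dq)).
  by rewrite /= -![_ *: _]/(_ * _); ring.
have ds x : is_derive x (e i) (fun x => u x * sin (q x))
    (k i * (u x * cos (q x)) + 'D_(e i) u x * sin (q x)).
  have dq := is_derive_comp_affine (fun h => qE i h x) (is_derive_sin (q x)).
  apply: (is_derive_eq (is_deriveM (du x) dq)).
  by rewrite /= -![_ *: _]/(_ * _); ring.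
have rdu : rapid ('D_(e i) u) by exact: rapid_derive.
have rcu : rapid (fun x => c i x * u x) by exact: rapid_coord.
case: wE => ->; (split=> [x||]; first by [have [] := dc x|have [] := ds x]).
- rewrite (_ : 'D_(e i) _ = fun x => - k i * (u x * sin (q x)) +
    'D_(e i) u x * cos (q x)); first by apply: span_lin; [exact: Ks|exact: Kc].
  by apply/funext => x; have [_ ->] := dc x.
- by under eq_fun do rewrite mulrA; exact: Kc.
- rewrite (_ : 'D_(e i) _ = fun x => k i * (u x * cos (q x)) +
    'D_(e i) u x * sin (q x)); first by apply: span_lin; [exact: Kc|exact: Ks].
  by apply/funext => x; have [_ ->] := ds x.
- by under eq_fun do rewrite mulrA; exact: Ks.
Qed.

End Rapid.
Arguments rapid_bounded {R V I e c u}.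

(** * Cosine and sine transforms on the line *)

Section Line.
Context {R : realType}.
Implicit Types (u v w : R -> R) (x y t : R).
Local Notation leb := (@lebesgue_measure R).

Definition integralR u : R := \int[leb]_x u x.

(** The class on the line: one direction and one coordinate. *)
Definition rapid1 u := rapid (fun _ : unit => 1 : R) (fun _ : unit => @id R) u.

Lemma rapid1_coind (K : set (R -> R)) :
  (forall u, K u -> [/\ bounded_fct u, forall x, derivable u x 1,
     span (K `|` rapid1) ('D_1 u) & span (K `|` rapid1) (fun x => x * u x)]) ->
  K `<=` rapid1.
Proof.
by move=> KP; apply: rapid_coind => u /KP[bu du su mu]; split=> // _; split.
Qed.

Lemma rapid1_bounded u : rapid1 u -> bounded_fct u.
Proof. exact: rapid_bounded. Qed.

Lemma rapid1_derivable u x : rapid1 u -> derivable u x 1.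
Proof. exact: (@rapid_derivable _ _ _ _ _ _ tt). Qed.

Lemma rapid1_derive u : rapid1 u -> rapid1 ('D_1 u).
Proof. exact: (@rapid_derive _ _ _ _ _ _ tt). Qed.

Lemma rapid1_mulx u : rapid1 u -> rapid1 (fun x => x * u x).
Proof. exact: (@rapid_coord _ _ _ _ _ _ tt). Qed.

Lemma rapid1_decay u : rapid1 u -> exists C : R, forall x, `|u x| <= C / oneDsqr x.
Proof. exact: (@rapid_decay _ _ _ _ _ _ tt). Qed.

Lemma derivable1_continuous u : (forall x, derivable u x 1) -> continuous u.
Proof. by move=> du x; apply/differentiable_continuous/derivable1_diffP. Qed.

Lemma derive_funE u (du : R -> R) : (forall x, is_derive x 1 u (du x)) ->
  'D_1 u = du.
Proof. by move=> h; apply/funext => x; have [_ ->] := h x. Qed.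

Lemma rapid1_continuous u : rapid1 u -> continuous u.
Proof.
by move=> ru; apply: derivable1_continuous => x; exact: rapid1_derivable.
Qed.

Lemma oneDsqr_gt0 (x : R) : 0 < oneDsqr x.
Proof. by rewrite (lt_le_trans ltr01)// oneDsqr_ge1. Qed.

Lemma integrable_oneDsqrV (C : R) :
  leb.-integrable setT (EFin \o fun x => C / oneDsqr x).
Proof.
suff h : leb.-integrable setT (EFin \o fun x => (oneDsqr x)^-1).
  have := integrableZl measurableT C h.
  by apply: eq_integrable => // x _; rewrite /= EFinM.
apply/integrableP; split.
  apply/measurable_EFinP; apply: continuous_measurable_fun.
  exact: continuous_oneDsqrV.
have nE x : `|(oneDsqr x)^-1| = (oneDsqr x)^-1 :> R.
  by rewrite ger0_norm.
under eq_integral => x _ do rewrite /= nE.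
rewrite (@ge0_symfun_integralT _ (fun x => (oneDsqr x)^-1))//=.
- rewrite (_ : [set x | _] = `[0, +oo[%classic); last first.
    by apply/seteqP; split => x/=; rewrite in_itv/= andbT.
  by rewrite integral0y_oneDsqr -EFinM ltry.
- exact: continuous_oneDsqrV.
- by move=> x/=; rewrite /oneDsqr sqrrN.
Qed.

(** The weight 1 / (1 + x^2) serves as a common integrable majorant. *)
Lemma dominated_integrable1 u (C : R) : continuous u ->
  (forall x, `|u x| <= C / oneDsqr x) -> leb.-integrable setT (EFin \o u).
Proof.
move=> cu uC; apply: le_integrable (integrable_oneDsqrV C) => //.
  by apply/measurable_EFinP; exact: continuous_measurable_fun.
by move=> x _ /=; rewrite lee_fin (le_trans (uC x))// ler_norm.
Qed.

Lemma rapid1_integrable u : rapid1 u -> leb.-integrable setT (EFin \o u).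
Proof.
move=> ru; have [C uC] := rapid1_decay ru.
exact: dominated_integrable1 (rapid1_continuous ru) uC.
Qed.

Lemma integralR_lin (a : R) u v : leb.-integrable setT (EFin \o u) ->
  leb.-integrable setT (EFin \o v) ->
  integralR (fun x => a * u x + v x) = a * integralR u + integralR v.
Proof.
move=> iu iv; rewrite /integralR RintegralD ?RintegralZl//.
have := integrableZl measurableT a iu.
by apply: eq_integrable => // x _; rewrite /= EFinM.
Qed.

Lemma ler_integralR u (C : R) : continuous u ->
  (forall x, `|u x| <= C / oneDsqr x) ->
  `|integralR u| <= integralR (fun x => C / oneDsqr x).
Proof.
move=> cu uC; have iu := dominated_integrable1 cu uC.
rewrite (le_trans (le_normr_Rintegral _ iu))//.
apply: le_Rintegral => //; last exact: integrable_oneDsqrV.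
exact: integrable_norm.
Qed.

(** The fundamental theorem of calculus on [-(n+1), n+1] gives boundary values
    that tend to zero; dominated convergence passes to the whole line.  Applied to
    products, it is integration by parts. *)
Lemma integralR_derive u : rapid1 u -> integralR ('D_1 u) = 0.
Proof.
move=> ru; have rdu := rapid1_derive ru.
have cu := rapid1_continuous ru; have cdu := rapid1_continuous rdu.
have [C uC] := rapid1_decay ru.
pose f n := ('D_1 u) \_ `[(- n.+1%:R)%R, n.+1%:R].
have fu x : (f n x)%:E @[n --> \oo] --> ('D_1 u x)%:E.
  apply: cvg_near_cst; near=> n; rewrite /f patchE mem_set//=.
  rewrite in_itv/= -ler_norml (@le_trans _ _ n%:R)// ?ler_nat//.
  by near: n; exact: nbhs_infty_ger.
have mf n : measurable_fun setT (EFin \o f n).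
  apply/measurable_EFinP; apply/(measurable_restrict _ _ _) => //.
  by rewrite setTI; apply: measurable_funTS; exact: continuous_measurable_fun.
have /integrableP[mdu _] := rapid1_integrable rdu.
have bf : {ae leb, forall x n, setT x -> (`|(f n x)%:E| <= `|('D_1 u x)%:E|)%E}.
  apply/aeW => x n _; rewrite lee_fin /f patchE; case: ifP => // _.
  by rewrite normr0.
have [|_ _] := @dominated_convergence _ _ R leb setT measurableT
  (fun n => EFin \o f n) (EFin \o 'D_1 u) (abse \o (EFin \o 'D_1 u))
  mf mdu (aeW leb _) (integrable_abse (rapid1_integrable rdu)) bf.
  by move=> x _; exact: fu.
have -> : (fun n => \int[leb]_(x in setT) (EFin \o f n) x)%E =
    fun n => ((u n.+1%:R - u (- n.+1%:R))%:E).
  apply/funext => n.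
  have -> : EFin \o f n = (EFin \o 'D_1 u) \_ `[(- n.+1%:R)%R, n.+1%:R].
    by apply/funext => x; rewrite /f /= !patchE; case: ifP.
  rewrite -integral_mkcond (@continuous_FTC2 _ _ u) ?EFinB//.
  - by rewrite gtrN// ltr0n.
  - by apply: continuous_subspaceT.
  - split=> [x _||]; first exact: rapid1_derivable.
      by apply: cvg_at_right_filter; exact: cu.
    by apply: cvg_at_left_filter; exact: cu.
  - by move=> x _; rewrite derive1E.
move=> h1.
have h2 : u n.+1%:R - u (- n.+1%:R) @[n --> \oo] --> (0 : R).
  have h0 : (2 * `|C|) * (harmonic n) @[n --> \oo] --> (0 : R).
    by rewrite -(mulr0 (2 * `|C|)); apply: cvgMr; exact: cvg_harmonic.
  apply/norm_cvg0P; apply: squeeze_cvgr h0; last exact: cvg_cst.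
  apply: nearW => n; rewrite normr_ge0/= (le_trans (ler_normB _ _))//.
  rewrite mulrAC -mulrA mulr_natl mulr2n.
  have hn x : x = n.+1%:R \/ x = - n.+1%:R -> `|u x| <= harmonic n * `|C|.
    move=> hx; rewrite (le_trans (uC x))// (le_trans (ler_norm _))// normrM mulrC.
    rewrite ler_wpM2r// ger0_norm// /harmonic/=.
    rewrite lef_pV2 ?posrE ?oneDsqr_gt0// /oneDsqr.
    have -> : x ^+ 2 = n.+1%:R ^+ 2 by case: hx => ->; rewrite ?sqrrN.
    rewrite (@le_trans _ _ (n.+1%:R ^+ 2))// ?lerDr//.
    by rewrite expr2 ler_peMr// ler1n.
  by apply: lerD; apply: hn; [left|right].
have {}h2 : (u n.+1%:R - u (- n.+1%:R))%:E @[n --> \oo] --> (0 : R)%:E.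
  exact: cvg_comp h2 _.
rewrite /integralR /Rintegral -[X in fine X](cvg_lim _ h1)//.
by rewrite (cvg_lim _ h2).
Unshelve. all: by end_near. Qed.

Definition cos_tr u (x : R) : R := integralR (fun t => u t * cos (t * x)).
Definition sin_tr u (x : R) : R := integralR (fun t => u t * sin (t * x)).

Lemma is_derive_cosM (a y : R) :
  is_derive y 1 (fun z : R => cos (a * z)) (- a * sin (a * y)).
Proof.
by apply: is_derive_eq; rewrite [_%:A]mulr1; ring.
Qed.

Lemma is_derive_sinM (a y : R) :
  is_derive y 1 (fun z : R => sin (a * z)) (a * cos (a * y)).
Proof.
by apply: is_derive_eq; rewrite [_%:A]mulr1; ring.
Qed.

Lemma cos_norm_le1 (x : R) : `|cos x| <= 1.
Proof. by rewrite ler_norml cos_geN1 cos_le1. Qed.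

Lemma sin_norm_le1 (x : R) : `|sin x| <= 1.
Proof. by rewrite ler_norml sin_geN1 sin_le1. Qed.

Lemma tr_integrable u (w : R -> R) : rapid1 u -> continuous w ->
  (forall t, `|w t| <= 1) ->
  leb.-integrable setT (EFin \o (fun t => u t * w t)).
Proof.
move=> ru cw w1; have [C uC] := rapid1_decay ru.
apply: (@dominated_integrable1 _ C) => t.
  by apply: cvgM; [exact: rapid1_continuous|exact: cw].
exact: le_mull_bound.
Qed.

Lemma continuous_cosM (a : R) : continuous (fun t : R => cos (t * a)).
Proof.
apply: derivable1_continuous => t; under eq_fun do rewrite mulrC.
by apply: (@ex_derive _ _ _ _ _ _ _ (is_derive_cosM a t)).
Qed.

Lemma continuous_sinM (a : R) : continuous (fun t : R => sin (t * a)).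
Proof.
apply: derivable1_continuous => t; under eq_fun do rewrite mulrC.
by apply: (@ex_derive _ _ _ _ _ _ _ (is_derive_sinM a t)).
Qed.

Lemma cos_tr_integrable u x : rapid1 u ->
  leb.-integrable setT (EFin \o (fun t => u t * cos (t * x))).
Proof.
move=> ru; apply: tr_integrable => //; first exact: continuous_cosM.
by move=> t; exact: cos_norm_le1.
Qed.

Lemma sin_tr_integrable u x : rapid1 u ->
  leb.-integrable setT (EFin \o (fun t => u t * sin (t * x))).
Proof.
move=> ru; apply: tr_integrable => //; first exact: continuous_sinM.
by move=> t; exact: sin_norm_le1.
Qed.

(** Differentiation under the integral sign with a majorant valid for all
    parameters, in the form of a single [is_derive]. *)
Lemma is_derive_under_Rintegral (D : set R) (f df : R -> R -> R) (G : R -> R)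
    (x : R) : measurable D ->
  (forall y, leb.-integrable D (EFin \o f y)) ->
  (forall y t : R, is_derive y 1 (f ^~ t) (df y t)) ->
  (forall t, 0 <= G t) -> leb.-integrable D (EFin \o G) ->
  (forall y t, D t -> `|df y t| <= G t) ->
  is_derive x 1 (fun y => \int[leb]_(t in D) f y t) (\int[leb]_(t in D) df x t).
Proof.
move=> mD intf fdf G0 iG dfG.
have dfE y t : partial1of2 f y t = df y t.
  by rewrite partial1of2E; have [_ ->] := fdf y t.
have Ix : `](x - 1), (x + 1)[%classic x.
  by rewrite /= in_itv/= ltrBlDr ltrDl ltr01.
have h2 y t : `](x - 1), (x + 1)[%classic y -> D t ->
  derivable (f ^~ t) y 1 by move=> _ _; have [] := fdf y t.
have h3 y t : `](x - 1), (x + 1)[%classic y -> D t ->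
    `|partial1of2 f y t| <= G t by rewrite dfE => _; exact: dfG.
apply: DeriveDef.
  exact: (@derivable_under_integral R _ _ leb f D mD x _ _ Ix
    (fun x _ => intf x) h2 _ G0 iG h3).
rewrite -derive1E.
rewrite (@differentiation_under_integral R _ _ leb f D mD x _ _ Ix
    (fun x _ => intf x) h2 _ G0 iG h3).
by apply: eq_Rintegral => t _; exact: dfE.
Qed.

Lemma is_derive_under_integral (f df : R -> R -> R) (C x : R) :
  (forall y, leb.-integrable setT (EFin \o f y)) ->
  (forall y t : R, is_derive y 1 (f ^~ t) (df y t)) ->
  (forall y t, `|df y t| <= C / oneDsqr t) ->
  is_derive x 1 (fun x => integralR (f x)) (integralR (df x)).
Proof.
move=> intf fdf dfC.
have C0 : 0 <= C.
  have := le_trans (normr_ge0 _) (dfC 0 0).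
  by rewrite /oneDsqr expr0n addr0 divr1.
apply: (is_derive_under_Rintegral (G := fun t => C / oneDsqr t)) => //.
  by move=> t; rewrite divr_ge0// ltW// oneDsqr_gt0.
exact: integrable_oneDsqrV.
Qed.

Lemma is_derive_cos_tr u (x : R) : rapid1 u ->
  is_derive x 1 (cos_tr u) (- sin_tr (fun t => t * u t) x).
Proof.
move=> ru; have rtu := rapid1_mulx ru; have [C uC] := rapid1_decay rtu.
have -> : - sin_tr (fun t => t * u t) x =
    integralR (fun t => (-1) * (t * u t * sin (t * x)) + 0).
  rewrite integralR_lin ?mulN1r.
  - by rewrite /integralR Rintegral_cst// mul0r addr0.
  - exact: sin_tr_integrable.
  - exact: integrable0.
apply: (@is_derive_under_integral (fun x t => u t * cos (t * x))
  (fun x t => -1 * (t * u t * sin (t * x)) + 0) C).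
- by move=> y; exact: cos_tr_integrable.
- move=> y t; apply: (is_derive_eq (is_deriveZ (u t) (is_derive_cosM t y))).
  by rewrite -[_ *: _]/(_ * _); ring.
- move=> y t; rewrite addr0 mulN1r normrN.
  exact: le_mull_bound (uC t) (sin_norm_le1 _).
Qed.

Lemma is_derive_sin_tr u (x : R) : rapid1 u ->
  is_derive x 1 (sin_tr u) (cos_tr (fun t => t * u t) x).
Proof.
move=> ru; have rtu := rapid1_mulx ru; have [C uC] := rapid1_decay rtu.
apply: (@is_derive_under_integral (fun x t => u t * sin (t * x))
  (fun x t => t * u t * cos (t * x)) C).
- by move=> y; exact: sin_tr_integrable.
- move=> y t; apply: (is_derive_eq (is_deriveZ (u t) (is_derive_sinM t y))).
  by rewrite -[_ *: _]/(_ * _); ring.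
- by move=> y t; exact: le_mull_bound (uC t) (cos_norm_le1 _).
Qed.

Lemma derive_cos_tr u : rapid1 u ->
  'D_1 (cos_tr u) = fun x : R => - sin_tr (fun t => t * u t) x.
Proof. by move=> ru; apply/funext => x; have [_ ->] := is_derive_cos_tr x ru. Qed.

Lemma derive_sin_tr u : rapid1 u ->
  'D_1 (sin_tr u) = cos_tr (fun t => t * u t).
Proof. by move=> ru; apply/funext => x; have [_ ->] := is_derive_sin_tr x ru. Qed.

Lemma rapid1_wave u (a : R) : rapid1 u ->
  rapid1 (fun t => u t * cos (t * a)) /\ rapid1 (fun t => u t * sin (t * a)).
Proof.
apply: (@rapid_wave R R unit _ _ (fun t => t * a) (fun=> a)) => _ h x.
by rewrite -[_ *: _]/(_ * _) mulr1 mulrDl.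
Qed.

(** Integration by parts: the integral over t of the derivative of
    u(t) sin(t x) is zero. *)
Lemma mul_cos_tr u (x : R) : rapid1 u -> x * cos_tr u x = - sin_tr ('D_1 u) x.
Proof.
move=> ru; have rdu := rapid1_derive ru; have [rc rs] := rapid1_wave x ru.
have := integralR_derive rs.
have -> : 'D_1 (fun t => u t * sin (t * x)) =
    fun t => x * (u t * cos (t * x)) + 'D_1 u t * sin (t * x).
  apply/funext => t.
  have d1 : is_derive t 1 u ('D_1 u t).
    by apply: derivableP; exact: rapid1_derivable.
  have d2 := is_derive_sinM x t.
  under eq_fun do rewrite (mulrC _ x).
  have [_ ->] := is_deriveM d1 d2.
  by rewrite -![_ *: _]/(_ * _) (mulrC x t); ring.
rewrite integralR_lin; [|exact: cos_tr_integrable|exact: sin_tr_integrable].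
by move/eqP; rewrite addr_eq0 => /eqP.
Qed.

Lemma mul_sin_tr u (x : R) : rapid1 u -> x * sin_tr u x = cos_tr ('D_1 u) x.
Proof.
move=> ru; have rdu := rapid1_derive ru; have [rc rs] := rapid1_wave x ru.
have := integralR_derive rc.
have -> : 'D_1 (fun t => u t * cos (t * x)) =
    fun t => - x * (u t * sin (t * x)) + 'D_1 u t * cos (t * x).
  apply/funext => t.
  have d1 : is_derive t 1 u ('D_1 u t).
    by apply: derivableP; exact: rapid1_derivable.
  have d2 := is_derive_cosM x t.
  under eq_fun do rewrite (mulrC _ x).
  have [_ ->] := is_deriveM d1 d2.
  by rewrite -![_ *: _]/(_ * _) (mulrC x t); ring.
rewrite integralR_lin; [|exact: sin_tr_integrable|exact: cos_tr_integrable].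
by rewrite mulNr => /eqP; rewrite addrC subr_eq0 => /eqP.
Qed.

Lemma cos_tr_lin (a : R) u v : rapid1 u -> rapid1 v ->
  cos_tr (fun t => a * u t + v t) = fun x => a * cos_tr u x + cos_tr v x.
Proof.
move=> ru rv; apply/funext => x; rewrite /cos_tr -integralR_lin.
- by congr integralR; apply/funext => t; ring.
- exact: cos_tr_integrable.
- exact: cos_tr_integrable.
Qed.

Lemma sin_tr_lin (a : R) u v : rapid1 u -> rapid1 v ->
  sin_tr (fun t => a * u t + v t) = fun x => a * sin_tr u x + sin_tr v x.
Proof.
move=> ru rv; apply/funext => x; rewrite /sin_tr -integralR_lin.
- by congr integralR; apply/funext => t; ring.
- exact: sin_tr_integrable.
- exact: sin_tr_integrable.
Qed.

Lemma rapid1_tr_bounded u : rapid1 u ->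
  bounded_fct (cos_tr u) /\ bounded_fct (sin_tr u).
Proof.
move=> ru; have [C uC] := rapid1_decay ru.
split; exists (integralR (fun x => C / oneDsqr x)) => x; apply: ler_integralR.
- by have [rc _] := rapid1_wave x ru; exact: rapid1_continuous.
- by move=> t; exact: le_mull_bound (uC t) (cos_norm_le1 _).
- by have [_ rs] := rapid1_wave x ru; exact: rapid1_continuous.
- by move=> t; exact: le_mull_bound (uC t) (sin_norm_le1 _).
Qed.

(** The transforms exchange derivatives and multiplication by the variable, so
    the transforms of rapidly decreasing functions form a closed class. *)
Lemma rapid1_tr u : rapid1 u -> rapid1 (cos_tr u) /\ rapid1 (sin_tr u).
Proof.
pose K : set (R -> R) := fun w => exists2 u, rapid1 u &
  w = cos_tr u \/ w = sin_tr u.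
suff KP : K `<=` rapid1.
  by move=> ru; split; apply: KP; exists u => //; [left|right].
have Kc v : rapid1 v ->
    span (K `|` rapid1) (cos_tr v).
  by move=> rv; apply: span_gen; left; exists v => //; left.
have Ks v : rapid1 v ->
    span (K `|` rapid1) (sin_tr v).
  by move=> rv; apply: span_gen; left; exists v => //; right.
have spN w : span (K `|` rapid1) w ->
    span (K `|` rapid1) (fun x => - w x).
  move=> sw; have := span_lin (-1) sw (span_zero _).
  by under eq_fun do rewrite mulN1r addr0.
apply: rapid1_coind => w [{}u ru wE]; have [bc bs] := rapid1_tr_bounded ru.
case: wE => ->; (split=> // [x||]).
- by have [] := is_derive_cos_tr x ru.
- by rewrite derive_cos_tr//; apply/spN/Ks; exact: rapid1_mulx.
- under eq_fun do rewrite mul_cos_tr//.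
  by apply/spN/Ks; exact: rapid1_derive.
- by have [] := is_derive_sin_tr x ru.
- by rewrite derive_sin_tr//; apply/Kc; exact: rapid1_mulx.
- under eq_fun do rewrite mul_sin_tr//.
  by apply/Kc; exact: rapid1_derive.
Qed.

(** * Fourier inversion on the line *)

Definition gauss (x : R) : R := expR (- (x ^+ 2 / 2)).

Lemma is_derive_gauss (x : R) : is_derive x 1 gauss (- (x * gauss x)).
Proof.
rewrite /gauss; apply: is_derive_eq.
by rewrite -![_ *: _]/(_ * _); field.
Qed.

Lemma gauss_gt0 x : 0 < gauss x.
Proof. exact: expR_gt0. Qed.

(** The n-th term of the exponential series at x^2 / 2 bounds x^{2n} times the
    Gaussian, and |x^n| <= 1 + x^{2n}. *)
Lemma gauss_moment_bounded n : bounded_fct (fun x => x ^+ n * gauss x).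
Proof.
have g1 x : gauss x <= 1.
  by rewrite /gauss -expR0 ler_expR oppr_le0 divr_ge0// sqr_ge0.
have h x : (x ^+ n) ^+ 2 * gauss x <= 2 ^+ n * n`!%:R.
  case: n => [|n]; first by rewrite !expr0 expr1n !mul1r.
  rewrite /gauss expRN ler_pdivrMr ?expR_gt0//.
  have x0 : 0 <= x ^+ 2 / 2 by rewrite divr_ge0// sqr_ge0.
  have := expR_ge1Dxn n x0.
  rewrite exprMn exprVn (exprAC x 2 n.+1) => hx.
  have {}hx : (x ^+ n.+1) ^+ 2 / 2 ^+ n.+1 / (n.+1)`!%:R <= expR (x ^+ 2 / 2).
    by apply: le_trans hx; rewrite lerDr.
  move: hx; rewrite -mulrA -invfM ler_pdivrMr; first by rewrite mulrC.
  by rewrite mulr_gt0// ?exprn_gt0// ltr0n fact_gt0.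
exists (1 + 2 ^+ n * n`!%:R) => x.
rewrite normrM (ger0_norm (ltW (gauss_gt0 x))).
have : `|x ^+ n| <= 1 + (x ^+ n) ^+ 2.
  by rewrite -(real_normK (num_real _)); nra.
move=> /(ler_wpM2r (ltW (gauss_gt0 x))) /le_trans; apply.
by rewrite mulrDl mul1r lerD.
Qed.

Lemma rapid1_gauss : rapid1 gauss.
Proof.
pose K : set (R -> R) := fun w => exists n, w = fun x => x ^+ n * gauss x.
suff KP : K `<=` rapid1.
  by apply: KP; exists 0; apply/funext => x; rewrite mul1r.
apply: rapid1_coind => w [n ->].
have Kn m : span (K `|` rapid1) (fun x => x ^+ m * gauss x).
  by apply: span_gen; left; exists m.
have dn (x : R) : is_derive x 1 (fun y : R => y ^+ n * gauss y)
    (n%:R * (x ^+ n.-1 * gauss x) + (- 1 * (x ^+ n.+1 * gauss x) + 0)).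
  have d1 : is_derive x 1 (fun y : R => y ^+ n) (n%:R * x ^+ n.-1).
    by apply: DeriveDef; [exact: exprn_derivable|rewrite exp_derive ?scaler1//].
  apply: (is_derive_eq (is_deriveM d1 (is_derive_gauss x))).
  by rewrite -![_ *: _]/(_ * _) exprS; ring.
split=> [|x||]; first exact: gauss_moment_bounded.
- by have [] := dn x.
- rewrite (derive_funE dn).
  by apply/span_lin/span_lin => //; exact: span_zero.
- by under eq_fun do rewrite mulrA -exprS.
Qed.

Lemma derive_gauss : 'D_1 gauss = fun x => - (x * gauss x).
Proof. exact: derive_funE is_derive_gauss. Qed.

(** Uniqueness for u' = - x u: the product of u and exp(x^2 / 2) has derivative
    zero. *)
Lemma gauss_ode u : (forall x, is_derive x 1 u (- (x * u x))) ->
  u = fun x => u 0 * gauss x.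
Proof.
move=> du; apply/funext => x.
have dv y : is_derive y 1 (fun y : R => u y * expR (y ^+ 2 / 2)) 0.
  have d2 : is_derive y 1 (fun y : R => expR (y ^+ 2 / 2))
      (y * expR (y ^+ 2 / 2)).
    by apply: is_derive_eq; rewrite -![_ *: _]/(_ * _); field.
  apply: (is_derive_eq (is_deriveM (du y) d2)).
  by rewrite -![_ *: _]/(_ * _); ring.
have := is_derive_0_is_cst x 0 dv.
rewrite expr0n mul0r expR0 mulr1 => <-.
by rewrite /gauss -mulrA -expRD subrr expR0 mulr1.
Qed.

Lemma cos_trN u : rapid1 u -> cos_tr (fun t => - u t) = fun x => - cos_tr u x.
Proof.
move=> ru; apply/funext => x; rewrite -mulN1r /cos_tr /integralR -RintegralZl//.
  by apply: eq_Rintegral => t _; ring.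
exact: cos_tr_integrable.
Qed.

Lemma sin_trN u : rapid1 u -> sin_tr (fun t => - u t) = fun x => - sin_tr u x.
Proof.
move=> ru; apply/funext => x; rewrite -mulN1r /sin_tr /integralR -RintegralZl//.
  by apply: eq_Rintegral => t _; ring.
exact: sin_tr_integrable.
Qed.

(** The value is sqrt (2 pi); positivity is what makes the inversion formula
    usable. *)
Definition gauss_mass : R := integralR gauss.

(** The cosine transform of the Gaussian satisfies u' = - x u, because the
    Gaussian does and transforms exchange derivative and multiplication. *)
Lemma cos_tr_gauss : cos_tr gauss = fun x => gauss_mass * gauss x.
Proof.
have rg := rapid1_gauss; have rtg := rapid1_mulx rg.
have -> : gauss_mass = cos_tr gauss 0.
  by rewrite /cos_tr; under eq_fun do rewrite mulr0 cos0 mulr1.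
apply: gauss_ode => x; rewrite mul_cos_tr// derive_gauss sin_trN//.
by rewrite opprK; exact: is_derive_cos_tr.
Qed.

Lemma sin_tr_gauss : sin_tr gauss = fun=> 0.
Proof.
have rg := rapid1_gauss; have rtg := rapid1_mulx rg.
have -> : (fun=> 0) = fun x => sin_tr gauss 0 * gauss x.
  apply/funext => x; rewrite /sin_tr; under eq_fun do rewrite mulr0 sin0 mulr0.
  by rewrite /integralR Rintegral_cst// !mul0r.
apply: gauss_ode => x; rewrite mul_sin_tr// derive_gauss cos_trN//.
by rewrite opprK; exact: is_derive_sin_tr.
Qed.

(** Comparison with exp(- x^2), whose integral is sqrt pi. *)
Lemma gauss_mass_gt0 : 0 < gauss_mass.
Proof.
have h : 0 < \int[leb]_x gauss_fun x.
  by rewrite /Rintegral integralT_gauss sqrtr_gt0 pi_gt0.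
apply: (lt_le_trans h); apply: le_Rintegral => //.
- exact: integrableT_gauss.
- exact: rapid1_integrable rapid1_gauss.
- move=> x _; rewrite /gauss /gauss_fun ler_expR lerN2.
  by rewrite ler_pdivrMr// ler_peMr ?sqr_ge0 ?ler1n.
Qed.

(** Hadamard division.  With v_n(t) the integral over s in [0, 1] of
    s^n u^{(n+1)}(a + s (t - a)), the quotient is v_0 and v_n' = v_{n+1}.  All v_n
    are bounded, and differentiating (t - a) v_0 = u repeatedly gives
    (t - a) v_n = u^{(n)} - n v_{n-1}, so multiplying some v_n by t stays in the
    span of the v_n and of the derivatives of u. *)
Lemma rapid1_div u (a : R) : rapid1 u -> u a = 0 ->
  exists2 v, rapid1 v & u = fun t => (t - a) * v t.
Proof.
move=> ru ua0; pose I01 : set R := [set` `[0, 1]].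
have mI : measurable I01 by exact: measurable_itv.
pose du n := iter n (fun w => 'D_1 w) u.
have rdu n : rapid1 (du n) by elim: n => //= n; exact: rapid1_derive.
pose f n t s : R := s ^+ n * du n.+1 (a + s * (t - a)).
pose v n t : R := \int[leb]_(s in I01) f n t s.
have cf n t : continuous (f n t).
  move=> s; apply: cvgM; first exact: exprn_continuous.
  apply: (@continuous_comp _ _ _ (fun s : R => a + s * (t - a))).
    by apply: derivable1_continuous => y; exact: ex_derive.
  exact: rapid1_continuous.
have intI (g : R -> R) : continuous g -> leb.-integrable I01 (EFin \o g).
  move=> cg; apply: continuous_compact_integrable; first exact: segment_compact.
  exact: continuous_subspaceT.
have bdf n : exists C : R, forall t s, I01 s -> `|f n t s| <= C.
  have [C duC] := rapid1_bounded (rdu n.+1); exists C => t s.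
  rewrite /I01/= in_itv/= => /andP[s0 s1]; rewrite /f mulrC.
  apply: le_mull_bound; first exact: duC.
  by rewrite normrX ger0_norm// exprn_ile1.
have dv n t : is_derive t 1 (v n) (v n.+1 t).
  have [C fC] := bdf n.+1.
  have C0 : 0 <= C.
    apply: le_trans (fC 0 0 _); first exact: normr_ge0.
    by rewrite /I01/= in_itv/= lexx ler01.
  apply: (is_derive_under_Rintegral (G := fun=> C)) => //.
  - by move=> y; exact/intI/cf.
  - move=> y s; rewrite /f.
    have d1 : is_derive y 1 (du n.+1 \o (fun y => a + s * (y - a)))
        (s * du n.+2 (a + s * (y - a))).
      apply: is_derive_comp_affine => [h|]; last first.
        by apply: derivableP; exact: rapid1_derivable.
      by rewrite -[_ *: _]/(_ * _); ring.
    apply: (is_derive_eq (is_deriveZ (s ^+ n) d1)).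
    by rewrite -[_ *: _]/(_ * _) exprSr; ring.
  - exact/intI/cst_continuous.
have v0 t : (t - a) * v 0 t = u t.
  rewrite /v -RintegralZl//; last exact/intI/cf.
  have dF (s : R) : is_derive s 1 (fun s : R => u (a + s * (t - a)))
      ((t - a) * f 0 t s).
    have -> : (fun s : R => u (a + s * (t - a))) =
      u \o (fun s : R => a + s * (t - a)) by [].
    rewrite /f expr0 mul1r; apply: is_derive_comp_affine => [h|]; last first.
      by apply: derivableP; exact: rapid1_derivable.
    by rewrite -[_ *: _]/(_ * _); ring.
  have cF : continuous (fun s : R => u (a + s * (t - a))).
    by apply: derivable1_continuous => s; have [] := dF s.
  rewrite /Rintegral (@continuous_FTC2 _ _ (fun s => u (a + s * (t - a)))) //=.
  - by rewrite mul1r mul0r addr0 ua0 subr0 addrC subrK.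
  - apply: continuous_subspaceT => s.
    by apply: cvgM; [exact: cvg_cst|exact: cf].
  - split=> [x _||]; first by have [] := dF x.
      by apply: cvg_at_right_filter; exact: cF.
    by apply: cvg_at_left_filter; exact: cF.
  - by move=> x _; rewrite derive1E; have [_ ->] := dF x.
have bdv n : bounded_fct (v n).
  have [C fC] := bdf n; exists (\int[leb]_(s in I01) C) => t.
  rewrite (le_trans (le_normr_Rintegral _ (intI _ (cf n t))))//.
  apply: le_Rintegral => //.
  - exact/integrable_norm/intI/cf.
  - exact/intI/cst_continuous.
  - by move=> s Is; exact: fC.
clearbody v.
(* For n = 0 the coefficient n removes the junk index n.-1. *)
have vS n t : t * v n t = a * v n t + (du n t + - n%:R * v n.-1 t).
  suff : (t - a) * v n t = du n t - n%:R * v n.-1 t.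
    by move=> h; rewrite mulNr -h; ring.
  elim: n t => [|n IHn] t; first by rewrite v0 mul0r subr0.
  have IHf : (fun t => (t - a) * v n t) = fun t => du n t - n%:R * v n.-1 t.
    exact/funext.
  have d1 : is_derive t 1 (fun t : R => (t - a) * v n t)
      (v n t + (t - a) * v n.+1 t).
    have d0 : is_derive t 1 (fun t : R => t - a) 1.
      by apply: is_derive_eq; rewrite subr0.
    apply: (is_derive_eq (is_deriveM d0 (dv n t))).
    by rewrite -![_ *: _]/(_ * _) mulr1 addrC.
  have d2 : is_derive t 1 (fun t : R => du n t - n%:R * v n.-1 t)
      (du n.+1 t - n%:R * v n t).
    have d3 : is_derive t 1 (du n) (du n.+1 t).
      by apply: derivableP; exact: rapid1_derivable.
    have d4 : is_derive t 1 (fun t : R => n%:R * v n.-1 t) (n%:R * v n t).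
      case: (n) => [|k] /=; last exact: is_deriveZ (dv k t).
      rewrite mul0r; under eq_fun do rewrite mul0r.
      exact: is_derive_cst.
    exact: is_deriveB.
  have [_ e2] := d2; have [_] := d1.
  rewrite IHf e2 -natr1 /=.
  move: (v n t) (v n.+1 t) ('D_1 _ t) => y z w; lra.
exists (v 0); last by apply/funext => t.
pose K : set (R -> R) := fun w => exists n, w = v n.
suff KP : K `<=` rapid1 by apply: KP; exists 0.
have Kv n : span (K `|` rapid1) (v n) by apply: span_gen; left; exists n.
apply: rapid1_coind => w [n ->]; split=> [|x||].
- exact: bdv.
- by have [] := dv n x.
- by rewrite (derive_funE (dv n)).
- under eq_fun do rewrite vS; apply: span_lin => //.
  have -> : (fun t => du n t + - n%:R * v n.-1 t) =
    (fun t => - n%:R * v n.-1 t + du n t) by apply/funext => t; rewrite addrC.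
  by apply: span_lin => //; apply: span_gen; right.
Qed.

(** For real u, [double_re u + i double_im u] is the integral over y of
    e^{- i x y} times the integral over t of e^{i y t} u(t): the transform of u
    followed by the one of opposite sign. *)
Definition double_re u x : R := cos_tr (cos_tr u) x + sin_tr (sin_tr u) x.
Definition double_im u x : R := cos_tr (sin_tr u) x - sin_tr (cos_tr u) x.

Lemma double_lin (a : R) u v x : rapid1 u -> rapid1 v ->
  double_re (fun t => a * u t + v t) x = a * double_re u x + double_re v x /\
  double_im (fun t => a * u t + v t) x = a * double_im u x + double_im v x.
Proof.
move=> ru rv; rewrite /double_re /double_im cos_tr_lin// sin_tr_lin//.
have [rcu rsu] := rapid1_tr ru; have [rcv rsv] := rapid1_tr rv.
by rewrite !(cos_tr_lin, sin_tr_lin)//; split; ring.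
Qed.

(** Multiplication by the variable becomes a derivative after one transform and
    multiplication by the variable again after the second. *)
Lemma double_mulx u x : rapid1 u ->
  double_re (fun t => t * u t) x = x * double_re u x /\
  double_im (fun t => t * u t) x = x * double_im u x.
Proof.
move=> ru; have rw : rapid1 (fun t => t * u t) by exact: rapid1_mulx.
have [rc rs] := rapid1_tr ru.
have cE : cos_tr (fun t => t * u t) = 'D_1 (sin_tr u) by rewrite derive_sin_tr.
have sE : sin_tr (fun t => t * u t) = fun t => - 'D_1 (cos_tr u) t.
  by apply/funext => t; have [_ ->] := is_derive_cos_tr t ru; rewrite opprK.
have rdc := rapid1_derive rc; have rds := rapid1_derive rs.
rewrite /double_re /double_im cE sE sin_trN// cos_trN//.
rewrite mulrBr mulrDr !(mul_cos_tr x)// !(mul_sin_tr x)//.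
by split; ring.
Qed.

Lemma double_gauss x :
  double_re gauss x = gauss_mass ^+ 2 * gauss x /\ double_im gauss x = 0.
Proof.
have rg := rapid1_gauss; have r0 : rapid1 (fun=> 0) by exact: rapid0.
rewrite /double_re /double_im cos_tr_gauss sin_tr_gauss.
have gE : (fun x => gauss_mass * gauss x) =
    (fun x => gauss_mass * gauss x + (fun=> 0) x).
  by apply/funext => t; rewrite addr0.
have e0 : (cos_tr (fun=> 0) x = 0) * (sin_tr (fun=> 0) x = 0).
  by split; rewrite /cos_tr /sin_tr /integralR;
    under eq_Rintegral do rewrite mul0r; rewrite Rintegral_cst// mul0r.
rewrite gE cos_tr_lin// sin_tr_lin// cos_tr_gauss sin_tr_gauss !e0.
by split; ring.
Qed.

(** With b the ratio of u to the Gaussian at x, u - b * gauss vanishes at x and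
    equals (t - x) v; the operator sends (t - x) v to a function vanishing at x,
    so the value at x is b times the one for the Gaussian. *)
Lemma inversion1 u x : rapid1 u ->
  double_re u x = gauss_mass ^+ 2 * u x /\ double_im u x = 0.
Proof.
move=> ru; have rg := rapid1_gauss.
have gx0 : gauss x != 0 by rewrite gt_eqF// gauss_gt0.
pose b := u x / gauss x.
have rw : rapid1 (fun t => - b * gauss t + u t) by exact: rapid_lin.
have [|v rv vE] := rapid1_div (a := x) rw.
  by rewrite mulNr /b divfK// addNr.
have rtv := rapid1_mulx rv.
have rd : rapid1 (fun t => - x * v t + t * v t) by exact: rapid_lin.
have uE : u = fun t => b * gauss t + (- x * v t + t * v t).
  apply/funext => t; have := congr1 (fun f => f t) vE; rewrite /= => h.
  by rewrite -mulrDl [- x + t]addrC -h; ring.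
rewrite [in LHS]uE; have [-> e2] := double_lin b x rg rd.
have [-> e4] := double_lin (- x) x rv rtv.
have [-> e6] := double_mulx x rv; have [-> e8] := double_gauss x.
split; first by rewrite mulNr addNr addr0 mulrCA /b divfK.
by rewrite uE e2 e4 e6 e8; ring.
Qed.

End Line.

(** * Partial Fourier transforms *)

Section Space.
Context {R : realType} {d : nat}.
Implicit Types (u v : 'cV[R]_d -> R) (x : 'cV[R]_d) (t : R) (i j : 'I_d).
Local Notation leb := (@lebesgue_measure R).
Local Notation dir i := (delta_mx i 0 : 'cV[R]_d).

Definition rapidd u := rapid (fun i => dir i) (fun i x => x i 0) u.

Lemma rapidd_coind (K : set ('cV[R]_d -> R)) :
  (forall u, K u -> bounded_fct u /\ forall i, [/\ forall x, derivable u x (dir i),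
     span (K `|` rapidd) ('D_(dir i) u)
   & span (K `|` rapidd) (fun x => x i 0 * u x)]) ->
  K `<=` rapidd.
Proof. by move=> KP; apply: rapid_coind => u /KP. Qed.

Lemma rapidd_derivable u i x : rapidd u -> derivable u x (dir i).
Proof. by move=> ru; exact: (rapid_derivable ru). Qed.

Lemma rapidd_derive u i : rapidd u -> rapidd ('D_(dir i) u).
Proof. by move=> ru; exact: rapid_derive. Qed.

Lemma rapidd_coord u i : rapidd u -> rapidd (fun x => x i 0 * u x).
Proof. by move=> ru; exact: (rapid_coord i ru). Qed.

(** The point x with coordinate i replaced by t; a partial transform acts on the
    line through x that it parametrizes. *)
Definition upd i t x : 'cV[R]_d := \col_j (if j == i then t else x j 0).

Lemma upd_eq i t x : upd i t x i 0 = t.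
Proof. by rewrite mxE eqxx. Qed.

Lemma upd_neq i j t x : j != i -> upd i t x j 0 = x j 0.
Proof. by rewrite mxE => /negbTE ->. Qed.

Lemma upd_id i x : upd i (x i 0) x = x.
Proof. by apply/colP => k; rewrite !mxE; case: eqP => // ->. Qed.

Lemma upd_upd i s t x : upd i s (upd i t x) = upd i s x.
Proof. by apply/colP => k; rewrite !mxE; case: eqP. Qed.

Lemma upd_shift i (h t : R) x : upd i (h + t) x = h *: dir i + upd i t x.
Proof.
by apply/colP => k; rewrite !mxE eqxx andbT; case: eqP => _;
  rewrite ?mulr1// mulr0 add0r.
Qed.

Lemma upd_dir i t (h : R) x : upd i t (h *: dir i + x) = upd i t x.
Proof.
by apply/colP => k; rewrite !mxE eqxx andbT; case: eqP => // _; rewrite mulr0 add0r.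
Qed.

Lemma upd_dir_neq i j t (h : R) x : j != i ->
  upd i t (h *: dir j + x) = h *: dir j + upd i t x.
Proof.
move=> ji; apply/colP => k; rewrite !mxE eqxx andbT; case: eqP => // ->.
by rewrite eq_sym (negbTE ji) mulr0 add0r.
Qed.

(** A directional derivative is an ordinary one along the line, which turns
    results about parameter integrals on R into partial derivatives. *)
Lemma is_derive_line (f : 'cV[R]_d -> R) (x w : 'cV[R]_d) (df : R) :
  is_derive (0 : R) 1 (fun h : R => f (h *: w + x)) df -> is_derive x w f df.
Proof.
move=> [dh hE]; apply: DeriveDef; first exact/derivable1P.
rewrite -hE; have := @derive_affine R R 'cV[R]_d R f (fun h : R => h *: w + x)
  0 1 w.
rewrite scale0r add0r => <- // h.
by rewrite addr0 [h *: 1]mulr1.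
Qed.

Lemma derive_dirE u (du : 'cV[R]_d -> R) (w : 'cV[R]_d) :
  (forall x, is_derive x w u (du x)) -> 'D_w u = du.
Proof. by move=> h; apply/funext => x; have [_ ->] := h x. Qed.

(** Restricting to a line parallel to an axis only keeps the conditions on that
    coordinate. *)
Lemma rapidd_slice u i x : rapidd u -> rapid1 (fun t => u (upd i t x)).
Proof.
move=> ru; pose K : set (R -> R) := fun w => exists2 u, rapidd u &
  w = fun t => u (upd i t x).
suff KP : K `<=` rapid1 by apply: KP; exists u.
apply: rapid1_coind => w [{}u {}ru ->].
have qE t (h : R) : upd i (h *: 1 + t) x = h *: dir i + upd i t x.
  by rewrite [h *: 1]mulr1 upd_shift.
split=> [|t||].
- by have [C uC] := rapid_bounded ru; exists C => t; exact: uC.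
- by apply: (derivable_affine (q := fun t => upd i t x) (qE t));
    exact: rapidd_derivable.
- apply: span_gen; left; exists ('D_(dir i) u); first exact: rapidd_derive.
  by apply/funext => t; exact: (derive_affine (q := fun t => upd i t x) _ (qE t)).
- apply: span_gen; left; exists (fun x => x i 0 * u x); first exact: rapidd_coord.
  by apply/funext => t; rewrite upd_eq.
Qed.

Lemma derive_slice u i x : rapidd u ->
  'D_1 (fun t => u (upd i t x)) = fun t => 'D_(dir i) u (upd i t x).
Proof.
move=> ru; apply/funext => t; apply: (derive_affine (q := fun t => upd i t x) u) => h.
by rewrite [h *: 1]mulr1 upd_shift.
Qed.

Definition cosd i u x : R := cos_tr (fun t => u (upd i t x)) (x i 0).
Definition sind i u x : R := sin_tr (fun t => u (upd i t x)) (x i 0).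

(** In the transformed coordinate the derivative is a multiplication by it
    beforehand; in the others it passes under the integral sign. *)
Lemma is_derive_cosd i j u x : rapidd u ->
  is_derive x (dir j) (cosd i u)
    (if j == i then - sind i (fun x => x i 0 * u x) x
     else cosd i ('D_(dir j) u) x).
Proof.
move=> ru; apply: is_derive_line; case: (eqVneq j i) => [->|ji].
- have -> : (fun h : R => cosd i u (h *: dir i + x)) =
      cos_tr (fun t => u (upd i t x)) \o (fun h => h + x i 0).
    apply/funext => h; rewrite /cosd /=.
    under eq_fun do rewrite upd_dir.
    by rewrite !mxE !eqxx mulr1.
  have rs : rapid1 (fun t => u (upd i t x)) by exact: rapidd_slice.
  have := is_derive_cos_tr (0 + x i 0) rs.
  move=> /(is_derive_comp_affine (q := fun h => h + x i 0) (k := 1) (v := 1)).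
  have -> : sind i (fun x => x i 0 * u x) x =
      sin_tr (fun t => t * u (upd i t x)) (0 + x i 0).
    by rewrite add0r /sind; under eq_fun do rewrite upd_eq.
  rewrite mul1r; apply => h.
  by rewrite -[_ *: _]/(_ * _) mulr1 addrA.
- have rdu : rapidd ('D_(dir j) u) by exact: rapidd_derive.
  have [C duC] : exists C : R, forall x, `|'D_(dir j) u x| <= C / oneDsqr (x i 0).
    exact: rapid_decay rdu.
  have -> : (fun h : R => cosd i u (h *: dir j + x)) = fun h =>
      integralR (fun t => u (h *: dir j + upd i t x) * cos (t * x i 0)).
    apply/funext => h; rewrite /cosd /=.
    under eq_fun do rewrite upd_dir_neq//.
    by rewrite !mxE eqxx andbT eq_sym (negbTE ji) mulr0 add0r.
  have -> : cosd i ('D_(dir j) u) x = integralR (fun t =>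
      'D_(dir j) u (0 *: dir j + upd i t x) * cos (t * x i 0)).
    by under [in RHS]eq_fun do rewrite scale0r add0r.
  apply: (is_derive_under_integral
    (f := fun h t => u (h *: dir j + upd i t x) * cos (t * x i 0))
    (df := fun h t => 'D_(dir j) u (h *: dir j + upd i t x) * cos (t * x i 0))
    (C := C)).
  + move=> h; apply: cos_tr_integrable.
    under eq_fun do rewrite -upd_dir_neq//.
    exact: rapidd_slice.
  + move=> h t.
    have dh : is_derive h 1 (u \o (fun h : R => h *: dir j + upd i t x))
        ('D_(dir j) u (h *: dir j + upd i t x)).
      have qE (k : R) : (k *: 1 + h) *: dir j + upd i t x =
          k *: dir j + (h *: dir j + upd i t x).
        by rewrite [k *: 1]mulr1 scalerDl addrA.
      apply: DeriveDef; last exact: (derive_affine _ qE).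
      by apply: (derivable_affine qE); exact: rapidd_derivable.
    apply: (is_derive_eq (is_deriveM dh (is_derive_cst (cos (t * x i 0)) h 1))).
    by rewrite scaler0 add0r -[_ *: _]/(_ * _) mulrC.
  + move=> h t; rewrite -upd_dir_neq//.
    apply: le_mull_bound (cos_norm_le1 _).
    by rewrite (le_trans (duC _))// upd_eq.
Qed.

Lemma is_derive_sind i j u x : rapidd u ->
  is_derive x (dir j) (sind i u)
    (if j == i then cosd i (fun x => x i 0 * u x) x
     else sind i ('D_(dir j) u) x).
Proof.
move=> ru; apply: is_derive_line; case: (eqVneq j i) => [->|ji].
- have -> : (fun h : R => sind i u (h *: dir i + x)) =
      sin_tr (fun t => u (upd i t x)) \o (fun h => h + x i 0).
    apply/funext => h; rewrite /sind /=.
    under eq_fun do rewrite upd_dir.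
    by rewrite !mxE !eqxx mulr1.
  have rs : rapid1 (fun t => u (upd i t x)) by exact: rapidd_slice.
  have := is_derive_sin_tr (0 + x i 0) rs.
  move=> /(is_derive_comp_affine (q := fun h => h + x i 0) (k := 1) (v := 1)).
  have -> : cosd i (fun x => x i 0 * u x) x =
      cos_tr (fun t => t * u (upd i t x)) (0 + x i 0).
    by rewrite add0r /cosd; under eq_fun do rewrite upd_eq.
  rewrite mul1r; apply => h.
  by rewrite -[_ *: _]/(_ * _) mulr1 addrA.
- have rdu : rapidd ('D_(dir j) u) by exact: rapidd_derive.
  have [C duC] : exists C : R, forall x, `|'D_(dir j) u x| <= C / oneDsqr (x i 0).
    exact: rapid_decay rdu.
  have -> : (fun h : R => sind i u (h *: dir j + x)) = fun h =>
      integralR (fun t => u (h *: dir j + upd i t x) * sin (t * x i 0)).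
    apply/funext => h; rewrite /sind /=.
    under eq_fun do rewrite upd_dir_neq//.
    by rewrite !mxE eqxx andbT eq_sym (negbTE ji) mulr0 add0r.
  have -> : sind i ('D_(dir j) u) x = integralR (fun t =>
      'D_(dir j) u (0 *: dir j + upd i t x) * sin (t * x i 0)).
    by under [in RHS]eq_fun do rewrite scale0r add0r.
  apply: (is_derive_under_integral
    (f := fun h t => u (h *: dir j + upd i t x) * sin (t * x i 0))
    (df := fun h t => 'D_(dir j) u (h *: dir j + upd i t x) * sin (t * x i 0))
    (C := C)).
  + move=> h; apply: sin_tr_integrable.
    under eq_fun do rewrite -upd_dir_neq//.
    exact: rapidd_slice.
  + move=> h t.
    have dh : is_derive h 1 (u \o (fun h : R => h *: dir j + upd i t x))
        ('D_(dir j) u (h *: dir j + upd i t x)).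
      have qE (k : R) : (k *: 1 + h) *: dir j + upd i t x =
          k *: dir j + (h *: dir j + upd i t x).
        by rewrite [k *: 1]mulr1 scalerDl addrA.
      apply: DeriveDef; last exact: (derive_affine _ qE).
      by apply: (derivable_affine qE); exact: rapidd_derivable.
    apply: (is_derive_eq (is_deriveM dh (is_derive_cst (sin (t * x i 0)) h 1))).
    by rewrite scaler0 add0r -[_ *: _]/(_ * _) mulrC.
  + move=> h t; rewrite -upd_dir_neq//.
    apply: le_mull_bound (sin_norm_le1 _).
    by rewrite (le_trans (duC _))// upd_eq.
Qed.

Lemma rapidd_wave u (q : 'cV[R]_d -> R) (k : 'I_d -> R) : rapidd u ->
  (forall i (h : R) x, q (h *: dir i + x) = h * k i + q x) ->
  rapidd (fun x => u x * cos (q x)) /\ rapidd (fun x => u x * sin (q x)).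
Proof. by move=> ru qE; exact: rapid_wave qE _ ru. Qed.

Lemma cosd_bounded u i : rapidd u -> bounded_fct (cosd i u) /\ bounded_fct (sind i u).
Proof.
move=> ru; have [C uC] : exists C : R, forall x, `|u x| <= C / oneDsqr (x i 0).
  exact: rapid_decay ru.
split; exists (integralR (fun t => C / oneDsqr t)) => x; apply: ler_integralR.
- by have [rc _] := rapid1_wave (x i 0) (rapidd_slice i x ru);
    exact: rapid1_continuous.
- move=> t; apply: le_mull_bound (cos_norm_le1 _).
  by rewrite (le_trans (uC _))// upd_eq.
- by have [_ rs] := rapid1_wave (x i 0) (rapidd_slice i x ru);
    exact: rapid1_continuous.
- move=> t; apply: le_mull_bound (sin_norm_le1 _).
  by rewrite (le_trans (uC _))// upd_eq.
Qed.

(** Dually, multiplication by the transformed coordinate is a derivative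
    beforehand, and the other coordinates are constants of the integral. *)
Lemma mul_cosd u i j x : rapidd u -> x j 0 * cosd i u x =
  if j == i then - sind i ('D_(dir i) u) x else cosd i (fun x => x j 0 * u x) x.
Proof.
move=> ru; case: eqVneq => [->|ji].
  rewrite /cosd mul_cos_tr; last exact: rapidd_slice.
  by rewrite derive_slice.
rewrite /cosd /cos_tr /integralR -RintegralZl//; last first.
  by apply: cos_tr_integrable; exact: rapidd_slice.
by apply: eq_Rintegral => t _; rewrite upd_neq// mulrA.
Qed.

Lemma mul_sind u i j x : rapidd u -> x j 0 * sind i u x =
  if j == i then cosd i ('D_(dir i) u) x else sind i (fun x => x j 0 * u x) x.
Proof.
move=> ru; case: eqVneq => [->|ji].
  rewrite /sind mul_sin_tr; last exact: rapidd_slice.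
  by rewrite derive_slice.
rewrite /sind /sin_tr /integralR -RintegralZl//; last first.
  by apply: sin_tr_integrable; exact: rapidd_slice.
by apply: eq_Rintegral => t _; rewrite upd_neq// mulrA.
Qed.

(** By the two previous rules, partial transforms of rapidly decreasing functions
    are permuted, up to sign, by derivatives and coordinates. *)
Lemma rapidd_tr u i : rapidd u -> rapidd (cosd i u) /\ rapidd (sind i u).
Proof.
pose K : set ('cV[R]_d -> R) := fun w => exists2 u, rapidd u &
  w = cosd i u \/ w = sind i u.
suff KP : K `<=` rapidd.
  by move=> ru; split; apply: KP; exists u => //; [left|right].
have Kc v : rapidd v -> span (K `|` rapidd) (cosd i v).
  by move=> rv; apply: span_gen; left; exists v => //; left.
have Ks v : rapidd v -> span (K `|` rapidd) (sind i v).
  by move=> rv; apply: span_gen; left; exists v => //; right.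
have spN w : span (K `|` rapidd) w -> span (K `|` rapidd) (fun x => - w x).
  move=> sw; have := span_lin (-1) sw (span_zero _).
  by under eq_fun do rewrite mulN1r addr0.
apply: rapidd_coind => w [{}u ru wE]; have [bc bs] := cosd_bounded i ru.
case: wE => ->; split => // j.
- have dc x := is_derive_cosd i j x ru.
  split=> [x||]; first by have [] := dc x.
    rewrite (derive_dirE dc); case: eqVneq => [_|_].
      by apply/spN/Ks; exact: rapidd_coord.
    by apply/Kc; exact: rapidd_derive.
  under eq_fun do rewrite mul_cosd//; case: eqVneq => [_|_].
    by apply/spN/Ks; exact: rapidd_derive.
  by apply/Kc; exact: rapidd_coord.
- have dc x := is_derive_sind i j x ru.
  split=> [x||]; first by have [] := dc x.
    rewrite (derive_dirE dc); case: eqVneq => [_|_].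
      by apply/Kc; exact: rapidd_coord.
    by apply/Ks; exact: rapidd_derive.
  under eq_fun do rewrite mul_sind//; case: eqVneq => [_|_].
    by apply/Kc; exact: rapidd_derive.
  by apply/Ks; exact: rapidd_coord.
Qed.

Lemma cosd_upd i u t x : cosd i u (upd i t x) = cos_tr (fun s => u (upd i s x)) t.
Proof. by rewrite /cosd upd_eq; under eq_fun do rewrite upd_upd. Qed.

Lemma sind_upd i u t x : sind i u (upd i t x) = sin_tr (fun s => u (upd i s x)) t.
Proof. by rewrite /sind upd_eq; under eq_fun do rewrite upd_upd. Qed.

Lemma cosd_lin (a : R) u v i : rapidd u -> rapidd v ->
  cosd i (fun x => a * u x + v x) = fun x => a * cosd i u x + cosd i v x.
Proof.
move=> ru rv; apply/funext => x; rewrite /cosd.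
by rewrite (@cos_tr_lin R a (fun t => u (upd i t x)) (fun t => v (upd i t x)));
  [|exact: rapidd_slice..].
Qed.

Definition crapid (f : 'cV[R]_d -> R[i]) :=
  rapidd (fun x => complex.Re (f x)) /\ rapidd (fun x => complex.Im (f x)).

Definition cint (f : R -> R[i]) : R[i] :=
  integralR (fun t => complex.Re (f t)) +i* integralR (fun t => complex.Im (f t)).

(** The Fourier transform in the coordinate i alone. *)
Definition ftm i (f : 'cV[R]_d -> R[i]) x : R[i] :=
  cint (fun t => cis (- (x i 0 * t)) * f (upd i t x)).

(** Its inverse up to the factor 2 pi: the phase has the opposite sign. *)
Definition ftp i (f : 'cV[R]_d -> R[i]) x : R[i] :=
  cint (fun t => cis (x i 0 * t) * f (upd i t x)).

Lemma ftmE i (f : 'cV[R]_d -> R[i]) x : crapid f -> ftm i f x =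
  (cosd i (fun x => complex.Re (f x)) x + sind i (fun x => complex.Im (f x)) x)
  +i* (cosd i (fun x => complex.Im (f x)) x - sind i (fun x => complex.Re (f x)) x).
Proof.
move=> [rf1 rf2]; rewrite /ftm /cint /cosd /sind /cos_tr /sin_tr.
have r1 := rapidd_slice i x rf1; have r2 := rapidd_slice i x rf2.
rewrite /integralR -RintegralD//; last 2 first.
  - exact: cos_tr_integrable.
  - exact: sin_tr_integrable.
rewrite -RintegralB//; last 2 first.
  - exact: cos_tr_integrable.
  - exact: sin_tr_integrable.
by congr (_ +i* _); apply: eq_Rintegral => t _; rewrite /cis cosN sinN;
  case: (f _) => a b /=; rewrite (mulrC t); ring.
Qed.

Lemma ftpE i (f : 'cV[R]_d -> R[i]) x : crapid f -> ftp i f x =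
  (cosd i (fun x => complex.Re (f x)) x - sind i (fun x => complex.Im (f x)) x)
  +i* (cosd i (fun x => complex.Im (f x)) x + sind i (fun x => complex.Re (f x)) x).
Proof.
move=> [rf1 rf2]; rewrite /ftp /cint /cosd /sind /cos_tr /sin_tr.
have r1 := rapidd_slice i x rf1; have r2 := rapidd_slice i x rf2.
rewrite /integralR -RintegralD//; last 2 first.
  - exact: cos_tr_integrable.
  - exact: sin_tr_integrable.
rewrite -RintegralB//; last 2 first.
  - exact: cos_tr_integrable.
  - exact: sin_tr_integrable.
by congr (_ +i* _); apply: eq_Rintegral => t _; rewrite /cis;
  case: (f _) => a b /=; rewrite (mulrC t); ring.
Qed.

Lemma crapid_ftp i f : crapid f -> crapid (ftp i f).
Proof.
move=> cf; have [rf1 rf2] := cf.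
have [rc1 rs1] := rapidd_tr i rf1; have [rc2 rs2] := rapidd_tr i rf2.
split; under eq_fun do rewrite ftpE//=; [exact: rapidB|exact: rapidD].
Qed.

(** On the line through x, this is [inversion1] for the real and the imaginary
    part. *)
Lemma ftm_ftp i f x : crapid f -> ftm i (ftp i f) x = (gauss_mass ^+ 2)%:C * f x.
Proof.
move=> cf; have [rf1 rf2] := cf; rewrite ftmE; last exact: crapid_ftp.
have r1 := rapidd_slice i x rf1; have r2 := rapidd_slice i x rf2.
set a := (fun t => complex.Re (f (upd i t x))) in r1.
set b := (fun t => complex.Im (f (upd i t x))) in r2.
have [rca rsa] := rapid1_tr r1; have [rcb rsb] := rapid1_tr r2.
have h1 : (fun t => complex.Re (ftp i f (upd i t x))) =
    fun t => - 1 * sin_tr b t + cos_tr a t.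
  apply/funext => t; by rewrite ftpE//= cosd_upd sind_upd mulN1r addrC.
have h2 : (fun t => complex.Im (ftp i f (upd i t x))) =
    fun t => 1 * cos_tr b t + sin_tr a t.
  by apply/funext => t; rewrite ftpE//= cosd_upd sind_upd mul1r.
rewrite /cosd /sind h1 h2 !(cos_tr_lin, sin_tr_lin)//.
have [da ia] := inversion1 (x i 0) r1; have [db ib] := inversion1 (x i 0) r2.
move: da ia db ib; rewrite /double_re /double_im => da ia db ib.
have ax : a (x i 0) = complex.Re (f x) by rewrite /a upd_id.
have bx : b (x i 0) = complex.Im (f x) by rewrite /b upd_id.
rewrite ax in da; rewrite bx in db.
move: da ia db ib; case: (f x) => p q /= da ia db ib.
move: da ia db ib; rewrite -[_ * (p +i* q)]/(_ +i* _) !mul0r subr0 addr0.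
move: (cos_tr (cos_tr a) _) (sin_tr (sin_tr a) _) (cos_tr (sin_tr a) _)
  (sin_tr (cos_tr a) _) (cos_tr (cos_tr b) _) (sin_tr (sin_tr b) _)
  (cos_tr (sin_tr b) _) (sin_tr (cos_tr b) _) (_ * p) (_ * q).
by move=> *; congr (_ +i* _); lra.
Qed.

Lemma crapidZ (a : R) f : crapid f -> crapid (fun x => a%:C * f x).
Proof.
move=> [r1 r2]; split.
  rewrite (_ : (fun x => _) = fun x => a * complex.Re (f x)); first exact: rapidZ.
  by apply/funext => x; case: (f x) => p q /=; ring.
rewrite (_ : (fun x => _) = fun x => a * complex.Im (f x)); first exact: rapidZ.
by apply/funext => x; case: (f x) => p q /=; ring.
Qed.

(** Undo the partial transforms one coordinate at a time. *)
Lemma ftm_surj (l : seq 'I_d) psi : crapid psi ->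
  exists2 chi, crapid chi & foldr ftm chi l = psi.
Proof.
elim: l psi => [|i l IHl] psi cpsi; first by exists psi.
have cp' : crapid (fun x => ((gauss_mass ^+ 2)^-1)%:C * psi x) by exact: crapidZ.
have [chi cchi chiE] := IHl _ (crapid_ftp i cp').
exists chi => //=; rewrite chiE; apply/funext => x; rewrite ftm_ftp//.
rewrite mulrA -rmorphM mulfV ?mul1r//.
by rewrite expf_neq0// gt_eqF// gauss_mass_gt0.
Qed.

End Space.

(** * Iterated integrals and the Fourier transform *)

Lemma lipschitz_continuous_at (R : realType) (V : normedModType R) (u : V -> R)
    (x : V) (C : R) :
  (forall y, `|u x - u y| <= C * `|x - y|) -> {for x, continuous u}.
Proof.
move=> uC; have k0 : 0 < `|C| + 1 by rewrite ltr_wpDl.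
apply/cvgrPdist_le => e e0; apply/nbhs_normP.
exists (e / (`|C| + 1)); first by rewrite /= divr_gt0.
move=> y; rewrite /ball_ /= ltr_pdivlMr// mulrC => xy.
rewrite (le_trans (uC y))// (le_trans _ (ltW xy))//.
by rewrite ler_wpM2r// (le_trans (ler_norm _))// lerDl.
Qed.

Section Slices.
Context {R : realType} {d : nat}.
Implicit Types (y : 'cV[R]_d) (s t : R) (i : 'I_d).
Local Notation leb := (@lebesgue_measure R).

(** The splitting of R^{d+1} into R and R^d along which iterated integrals are
    defined. *)
Definition consv t y : 'cV[R]_d.+1 := col_mx (t%:M : 'cV[R]_1) y.

Lemma consv0 t y : consv t y ord0 0 = t.
Proof.
rewrite /consv (_ : ord0 = lshift d (ord0 : 'I_1)); last exact: val_inj.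
by apply: etrans (col_mxEu _ _ _ _) _; rewrite mxE eqxx.
Qed.

Lemma consvS t y i : consv t y (lift ord0 i) 0 = y i 0.
Proof.
rewrite /consv (_ : lift ord0 i = rshift 1 i); last exact: val_inj.
exact: col_mxEd.
Qed.

Lemma colS_eq (x z : 'cV[R]_d.+1) : x ord0 0 = z ord0 0 ->
  (forall i, x (lift ord0 i) 0 = z (lift ord0 i) 0) -> x = z.
Proof.
move=> x0 xS; apply/colP => k.
by have [j ->|->] := unliftP ord0 k; [exact: xS|exact: x0].
Qed.

Lemma upd0_consv s t y : upd ord0 t (consv s y) = consv t y.
Proof.
apply: colS_eq => [|i]; first by rewrite upd_eq consv0.
by rewrite upd_neq ?consvS// -lift0.
Qed.

Lemma updS_consv i s t y : upd (lift ord0 i) t (consv s y) = consv s (upd i t y).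
Proof.
apply: colS_eq => [|j]; first by rewrite upd_neq ?consv0//.
rewrite consvS; have [->|ji] := eqVneq j i; first by rewrite !upd_eq.
by rewrite !upd_neq ?consvS// (inj_eq lift_inj).
Qed.

Lemma consv_eta (x : 'cV[R]_d.+1) : x = consv (x ord0 0) (\col_i x (lift ord0 i) 0).
Proof. by apply: colS_eq => [|i]; rewrite ?consv0// consvS mxE. Qed.

Lemma foldr_cosd_consv (f : 'cV[R]_d.+1 -> R) l t y :
  foldr cosd f (map (lift ord0) l) (consv t y) =
  foldr cosd (fun z => f (consv t z)) l y.
Proof.
elim: l y => //= i l IHl y; rewrite /cosd consvS.
by under eq_fun do rewrite updS_consv IHl.
Qed.

Lemma foldr_ftm_consv (f : 'cV[R]_d.+1 -> R[i]) l t y :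
  foldr ftm f (map (lift ord0) l) (consv t y) =
  foldr ftm (fun z => f (consv t z)) l y.
Proof.
elim: l y => //= i l IHl y; rewrite /ftm consvS.
by under eq_fun do rewrite updS_consv IHl.
Qed.

Lemma rapidd_consv (u : 'cV[R]_d.+1 -> R) t : rapidd u ->
  rapidd (fun y => u (consv t y)).
Proof.
move=> ru; pose K : set ('cV[R]_d -> R) := fun w => exists2 u : 'cV[R]_d.+1 -> R,
  rapidd u & w = fun y => u (consv t y).
suff KP : K `<=` rapidd by apply: KP; exists u.
apply: rapidd_coind => w [{}u {}ru ->].
have qE i y (h : R) : consv t (h *: delta_mx i 0 + y) =
    h *: delta_mx (lift ord0 i) 0 + consv t y.
  apply: colS_eq => [|j].
    by rewrite [RHS]mxE !consv0 [X in X + _]mxE [X in _ * X]mxE mulr0 add0r.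
  by rewrite [RHS]mxE !consvS !mxE; congr (_ * (nat_of_bool (_ && _))%:R + _).
split=> [|i]; last split=> [y||].
- by have [C uC] := rapid_bounded ru; exists C => y; exact: uC.
- by apply: (derivable_affine (q := consv t) (qE i y)); exact: rapidd_derivable.
- apply: span_gen; left; exists ('D_(delta_mx (lift ord0 i) 0) u).
    exact: rapidd_derive.
  by apply/funext => y; exact: (derive_affine (q := consv t) _ (qE i y)).
- apply: span_gen; left; exists (fun x : 'cV[R]_d.+1 => x (lift ord0 i) 0 * u x).
    exact: rapidd_coord.
  by apply/funext => y; rewrite consvS.
Qed.

End Slices.

Section Integral.
Context {R : realType}.
Local Notation leb := (@lebesgue_measure R).

(** A cosine transform at 0 is an integral, so the iterated integral is the value
    at 0 of the composite of all partial cosine transforms.  Partial transforms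
    keep the class, so linearity and convergence of the iterated integral follow
    coordinate by coordinate, without exchanging integrals. *)
Lemma integral_RdE (d : nat) (f : 'cV[R]_d -> R) :
  integral_Rd f = foldr cosd f (enum 'I_d) 0.
Proof.
elim: d f => [|d IHd] f; first by rewrite (_ : enum 'I_0 = [::])//; case: (enum _) => // -[].
rewrite enum_ordSl /= /cosd /cos_tr mxE.
under [in RHS]eq_fun do
  rewrite mulr0 cos0 mulr1 [0 in X in upd _ _ X]consv_eta upd0_consv.
under [in RHS]eq_fun do rewrite foldr_cosd_consv.
apply: eq_Rintegral => t _; rewrite IHd; congr (foldr _ _ _ _).
by apply/colP => i; rewrite !mxE.
Qed.

Lemma integral_Rd_lin (d : nat) (a : R) (u v : 'cV[R]_d -> R) :
  rapidd u -> rapidd v ->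
  integral_Rd (fun x => a * u x + v x) = a * integral_Rd u + integral_Rd v.
Proof.
rewrite !integral_RdE => ru rv.
suff [_ _ ->] : [/\ rapidd (foldr cosd u (enum 'I_d)),
    rapidd (foldr cosd v (enum 'I_d)) &
    foldr cosd (fun x => a * u x + v x) (enum 'I_d) =
    fun x => a * foldr cosd u (enum 'I_d) x + foldr cosd v (enum 'I_d) x] by [].
elim: (enum 'I_d) => //= i l [r1 r2 ->]; split.
- by have [] := rapidd_tr i r1.
- by have [] := rapidd_tr i r2.
- exact: cosd_lin.
Qed.

Lemma crapid_lin (d : nat) (a : R[i]) (f g : 'cV[R]_d -> R[i]) :
  crapid f -> crapid g -> crapid (fun x => a * f x + g x).
Proof.
case: a => a b [rf1 rf2] [rg1 rg2]; split.
  rewrite (_ : (fun x => _) = fun x => a * complex.Re (f x) +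
    (- b * complex.Im (f x) + complex.Re (g x))).
    by apply: rapid_lin => //; exact: rapid_lin.
  by apply/funext => x; case: (f x) (g x) => p q [p' q'] /=; ring.
rewrite (_ : (fun x => _) = fun x => a * complex.Im (f x) +
    (b * complex.Re (f x) + complex.Im (g x))).
  by apply: rapid_lin => //; exact: rapid_lin.
by apply/funext => x; case: (f x) (g x) => p q [p' q'] /=; ring.
Qed.

Lemma cintegral_lin (d : nat) (a : R[i]) (f g : 'cV[R]_d -> R[i]) :
  crapid f -> crapid g ->
  cintegral (fun x => a * f x + g x) = a * cintegral f + cintegral g.
Proof.
case: a => a b [rf1 rf2] [rg1 rg2]; rewrite /cintegral.
rewrite (_ : (fun x => complex.Re _) = fun x => a * complex.Re (f x) +
    (- b * complex.Im (f x) + complex.Re (g x))); last first.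
  by apply/funext => x; case: (f x) (g x) => p q [p' q'] /=; ring.
rewrite integral_Rd_lin//; last exact: rapid_lin.
rewrite integral_Rd_lin//.
rewrite (_ : (fun x => complex.Im (_ + _)) = fun x => a * complex.Im (f x) +
    (b * complex.Re (f x) + complex.Im (g x))); last first.
  by apply/funext => x; case: (f x) (g x) => p q [p' q'] /=; ring.
rewrite integral_Rd_lin//; last exact: rapid_lin.
rewrite integral_Rd_lin//.
by rewrite -[(a +i* b) * _ + _]/(_ +i* _); congr (_ +i* _); ring.
Qed.

Lemma crapid0 (d : nat) : crapid (fun _ : 'cV[R]_d => 0 : R[i]).
Proof. by split; exact: rapid0. Qed.

Lemma cintegral0 (d : nat) : cintegral (fun _ : 'cV[R]_d => 0 : R[i]) = 0.
Proof.
have := @cintegral_lin d (-1) _ _ (@crapid0 d) (@crapid0 d).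
by rewrite mulr0 addr0 mulN1r addNr.
Qed.

Lemma cintegralZ (d : nat) (a : R[i]) (f : 'cV[R]_d -> R[i]) :
  crapid f -> cintegral (fun x => a * f x) = a * cintegral f.
Proof.
move=> cf; have := cintegral_lin a cf (@crapid0 d).
by rewrite cintegral0 addr0 => <-; congr cintegral; apply/funext => x; rewrite addr0.
Qed.

Lemma dot_dir (d : nat) (k : 'cV[R]_d) (i : 'I_d) (h : R) (x : 'cV[R]_d) :
  dot k (h *: delta_mx i 0 + x) = h * k i 0 + dot k x.
Proof.
rewrite /dot (eq_bigr (fun j => h * (k j 0 * (j == i)%:R) + k j 0 * x j 0)).
  rewrite big_split/= -mulr_sumr (bigD1 i)//= eqxx mulr1 big1 ?addr0// => j ji.
  by rewrite (negbTE ji) mulr0.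
by move=> j _; rewrite !mxE eqxx andbT; ring.
Qed.

(** A plane wave has a linear phase, so [rapidd_wave] applies to the four products
    of real and imaginary parts. *)
Lemma crapid_cis (d : nat) (k : 'cV[R]_d) (f : 'cV[R]_d -> R[i]) :
  crapid f -> crapid (fun x => f x * cis (dot k x)).
Proof.
move=> [r1 r2].
have [c1 s1] := rapidd_wave r1 (@dot_dir d k).
have [c2 s2] := rapidd_wave r2 (@dot_dir d k).
split.
  rewrite (_ : (fun x => _) = fun x => complex.Re (f x) * cos (dot k x) -
    complex.Im (f x) * sin (dot k x)); first exact: rapidB.
  by apply/funext => x; case: (f x).
rewrite (_ : (fun x => _) = fun x => complex.Re (f x) * sin (dot k x) +
    complex.Im (f x) * cos (dot k x)); first exact: rapidD.
by apply/funext => x; case: (f x).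
Qed.

Lemma cisD (s t : R) : cis (s + t) = cis s * cis t.
Proof. by rewrite /cis cosD sinD -[RHS]/(_ +i* _) [cos s * sin t + _]addrC. Qed.

Lemma cis0 : cis 0 = 1 :> R[i].
Proof. by rewrite /cis cos0 sin0. Qed.

Lemma dotNl (d : nat) (k x : 'cV[R]_d) : dot (- k) x = - dot k x.
Proof. by rewrite /dot -sumrN; apply: eq_bigr => i _; rewrite mxE mulNr. Qed.

(** The phase is additive over the coordinates, so peeling off the first integral
    leaves a partial transform applied to a lower-dimensional Fourier
    transform. *)
Lemma fourier_ftm (d : nat) (chi : 'cV[R]_d -> R[i]) : crapid chi ->
  fourier chi = foldr ftm chi (enum 'I_d).
Proof.
elim: d chi => [|d IHd] chi cchi; apply/funext => xi.
  have -> : enum 'I_0 = [::] by case: (enum _) => // -[].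
  rewrite /fourier /cintegral /= /dot big_ord0 oppr0 cis0 mulr1.
  have -> : xi = 0 by apply/colP => -[].
  by case: (chi 0).
rewrite enum_ordSl /=.
pose H := foldr ftm chi (map (lift ord0) (enum 'I_d)).
rewrite -/H [xi in RHS]consv_eta /ftm consv0.
set t0 := xi ord0 0; set xi' := \col_i _.
transitivity (cint (fun t => cintegral (fun y : 'cV[R]_d =>
    chi (consv t y) * cis (- dot xi (consv t y))))); first by [].
congr cint; apply/funext => t.
have cchit : crapid (fun y => chi (consv t y)).
  by have [r1 r2] := cchi; split;
    [exact: (rapidd_consv t r1)|exact: (rapidd_consv t r2)].
rewrite upd0_consv /H foldr_ftm_consv -IHd// /fourier -cintegralZ; last first.
  have := crapid_cis (- xi') cchit.
  by under eq_fun do rewrite dotNl.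
congr cintegral; apply/funext => y; rewrite mulrCA -cisD; congr (_ * cis _).
rewrite -opprD /dot big_ord_recl consv0; congr (- (_ + _)).
by apply: eq_bigr => i _; rewrite consvS mxE.
Qed.

(** The surjectivity half of Fourier inversion on the Schwartz space. *)
Lemma fourier_surj (d : nat) (psi : 'cV[R]_d -> R[i]) : crapid psi ->
  exists2 chi, crapid chi & fourier chi = psi.
Proof.
move=> cpsi; have [chi cchi chiE] := ftm_surj (enum 'I_d) cpsi.
by exists chi => //; rewrite fourier_ftm.
Qed.

(** Each exponential turns the integral of psi into a value of its Fourier
    transform, at the opposite frequency. *)
Lemma cintegral_trig_poly (d : nat) (c : seq ('cV[int]_d * R[i]))
    (psi : 'cV[R]_d -> R[i]) : crapid psi ->
  cintegral (fun xi => trig_poly c xi * psi xi) =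
  \sum_(kc <- c) kc.2 * fourier psi (- map_mx intr kc.1).
Proof.
move=> cpsi; rewrite /trig_poly.
suff [] :
    crapid (fun xi =>
      (\sum_(kc <- c) kc.2 * cis (dot (map_mx intr kc.1) xi)) * psi xi) /\
    cintegral (fun xi =>
      (\sum_(kc <- c) kc.2 * cis (dot (map_mx intr kc.1) xi)) * psi xi)
     = \sum_(kc <- c) kc.2 * fourier psi (- map_mx intr kc.1) by [].
elim: c => [|[k a] c [IH1 IH2]].
  rewrite big_nil; under eq_fun do rewrite big_nil mul0r.
  by split; [exact: crapid0|exact: cintegral0].
have e : (fun xi =>
     (\sum_(kc <- (k, a) :: c) kc.2 * cis (dot (map_mx intr kc.1) xi)) * psi xi)
   = (fun xi => a * (psi xi * cis (dot (map_mx intr k) xi)) +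
     (\sum_(kc <- c) kc.2 * cis (dot (map_mx intr kc.1) xi)) * psi xi).
  by apply/funext => xi; rewrite big_cons/=; ring.
have ck := crapid_cis (map_mx intr k) cpsi.
rewrite e big_cons/= -IH2; split; first exact: crapid_lin.
rewrite cintegral_lin//; congr (a * _ + _); rewrite /fourier.
by under [in RHS]eq_fun do rewrite dotNl opprK.
Qed.

End Integral.

(** * Schwartz functions are the rapidly decreasing ones *)

Section Schwartz.
Context {R : realType} {d : nat}.
Implicit Types (u : 'cV[R]_d -> R) (f : 'cV[R]_d -> R[i]) (x y : 'cV[R]_d).
Local Notation dir i := (delta_mx i 0 : 'cV[R]_d).

Definition monomial (a : seq 'I_d) x : R := \prod_(i <- a) x i 0.

Lemma is_derive_coord (i j : 'I_d) x :
  is_derive x (dir j) (fun y => y i 0) (i == j)%:R.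
Proof.
have : is_derive x (dir j) (id \o (fun y => y i 0)) ((i == j)%:R * 1).
  by apply: is_derive_comp_affine => h; rewrite !mxE eqxx andbT.
by rewrite mulr1.
Qed.

(** Products of monomials and partial derivatives of u span a closed class:
    differentiating a monomial factor by factor stays in the span. *)
Lemma rapidd_of_bounds u :
  (forall s i x, derivable (partials s u) x (dir i)) ->
  (forall a s, bounded_fct (fun x => monomial a x * partials s u x)) ->
  rapidd u.
Proof.
move=> du bu; pose K : set ('cV[R]_d -> R) := fun w => exists a s,
  w = fun x => monomial a x * partials s u x.
suff KP : K `<=` rapidd.
  apply: KP; exists [::], [::]; apply/funext => x.
  by rewrite /monomial big_nil mul1r.
apply: rapidd_coind => w [a [s ->]]; split; first exact: bu.
move=> i; have mulcK v (j : 'I_d) : span K v -> span K (fun x => x j 0 * v x).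
  elim => {v} [v [a' [s' ->]]||b v v' _ IHv _ IHv'].
  - apply: span_gen; exists (j :: a'), s'; apply/funext => x.
    by rewrite /monomial big_cons mulrA.
  - by under eq_fun do rewrite mulr0; exact: span_zero.
  - rewrite (_ : (fun x => _) = fun x => b * (x j 0 * v x) + x j 0 * v' x).
      exact: span_lin.
    by apply/funext => x; ring.
have spanS v : span K v -> span (K `|` rapidd) v.
  by apply: span_mono => z Kz; left.
have [dw sdw] :
   (forall x, derivable (fun x => monomial a x * partials s u x) x (dir i)) /\
   span K ('D_(dir i) (fun x => monomial a x * partials s u x)).
  elim: a => [|j a [IH1 IH2]].
    have -> : (fun x => monomial [::] x * partials s u x) = partials s u.
      by apply/funext => x; rewrite /monomial big_nil mul1r.
    split; first exact: du.
    apply: span_gen; exists [::], (i :: s); apply/funext => x.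
    by rewrite /monomial big_nil mul1r.
  have e : (fun x => monomial (j :: a) x * partials s u x) =
     (fun x => x j 0 * (monomial a x * partials s u x)).
    by apply/funext => x; rewrite /monomial big_cons mulrA.
  have dj x : is_derive x (dir i) (fun x => x j 0 * (monomial a x * partials s u x))
     ((j == i)%:R * (monomial a x * partials s u x) +
      x j 0 * 'D_(dir i) (fun x => monomial a x * partials s u x) x).
    have d1 : is_derive x (dir i) (fun x => monomial a x * partials s u x)
       ('D_(dir i) (fun x => monomial a x * partials s u x) x).
      exact: derivableP.
    apply: (is_derive_eq (is_deriveM (is_derive_coord j i x) d1)).
    by rewrite -![_ *: _]/(_ * _) addrC; congr (_ + _); rewrite mulrC.
  rewrite e; split=> [x|]; first by have [] := dj x.
  rewrite (derive_dirE dj); apply: span_lin; last exact: mulcK.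
  by apply: span_gen; exists a, s.
split=> //; first exact: spanS.
by apply/spanS/mulcK/span_gen; exists a, s.
Qed.

Lemma rapidd_partials u s : rapidd u -> rapidd (partials s u).
Proof. by move=> ru; elim: s => //= i s; exact: rapidd_derive. Qed.

Lemma rapidd_monomial u a : rapidd u -> rapidd (fun x => monomial a x * u x).
Proof.
move=> ru; elim: a => [|i a IHa].
  rewrite (_ : (fun x => _) = u)//; apply/funext => x.
  by rewrite /monomial big_nil mul1r.
rewrite (_ : (fun x => _) = fun x => x i 0 * (monomial a x * u x)).
  exact: rapidd_coord.
by apply/funext => x; rewrite /monomial big_cons mulrA.
Qed.

Lemma lipschitz_of_derive (g : R -> R) (C : R) :
  (forall s : R, derivable g s 1) -> (forall s : R, `|'D_1 g s| <= C) ->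
  forall a b, `|g b - g a| <= C * `|b - a|.
Proof.
move=> dg gC a b; wlog ab : a b / a <= b => [h|].
  by have [/h//|/ltW/h] := leP a b; rewrite distrC (distrC a).
have [c _ ->] := @MVT_segment _ g ('D_1 g) a b ab
  (fun (x : R) _ => derivableP (dg x))
  (continuous_subspaceT (derivable1_continuous dg)).
by rewrite normrM ler_wpM2r.
Qed.

(** All partial derivatives are bounded, so the mean value inequality applies
    along each axis. *)
Lemma rapidd_lipschitz u : rapidd u ->
  exists C : R, forall i x (h : R), `|u (h *: dir i + x) - u x| <= C * `|h|.
Proof.
move=> ru.
have /(@fin_all_exists _ _ _)[C CP] : forall i, exists C : R, forall x,
    `|'D_(dir i) u x| <= C.
  by move=> i; exact: rapid_bounded (rapidd_derive i ru).
exists (\sum_i `|C i|) => i x h; pose g (s : R) := u (s *: dir i + x).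
have qE (s k : R) : (k *: 1 + s) *: dir i + x = k *: dir i + (s *: dir i + x).
  by rewrite [k *: 1]mulr1 scalerDl addrA.
have dg (s : R) : derivable g s 1.
  by apply: (derivable_affine (qE s)); exact: rapidd_derivable.
have gC (s : R) : `|'D_1 g s| <= \sum_i `|C i|.
  rewrite (_ : 'D_1 g s = 'D_(dir i) u (s *: dir i + x)); last first.
    exact: (derive_affine _ (qE s)).
  rewrite (le_trans (CP _ _))// (bigD1 i)//= (le_trans (ler_norm _))// lerDl.
  exact: sumr_ge0.
have := lipschitz_of_derive dg gC 0 h.
by rewrite /g scale0r add0r subr0.
Qed.

Lemma norm_coord_le (m n : nat) (x : 'M[R]_(m, n)) i j : `|x i j| <= `|x|.
Proof.
rewrite [leRHS]/Num.norm /= mx_normrE; apply/bigmax_geP; right.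
by exists (i, j).
Qed.

(** Moving from x to y one coordinate at a time, the Lipschitz bounds along the
    axes add up to a bound by the norm of y - x. *)
Lemma rapidd_continuous u : rapidd u -> continuous u.
Proof.
move=> ru x; have [C uC] := rapidd_lipschitz ru.
have C0 : (0 < d)%N -> 0 <= C.
  move=> d0; have := uC (Ordinal d0) x 1; rewrite normr1 mulr1.
  exact: le_trans.
(* z y l agrees with y at the coordinates in l and with x elsewhere. *)
pose z y l := foldr (fun i w => upd i (y i 0) w) x l.
have zl y l i : `|y i 0 - z y l i 0| <= `|y i 0 - x i 0|.
  elim: l => //= j l IHl; have [->|ij] := eqVneq i j; last by rewrite upd_neq.
  by rewrite upd_eq subrr normr0.
have uz y l : `|u (z y l) - u x| <= C * (\sum_(i <- l) `|y i 0 - x i 0|).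
  elim: l => [|i l IHl]; first by rewrite big_nil mulr0 subrr normr0.
  rewrite big_cons mulrDr /= -[X in `|X|](subrKA (u (z y l))).
  rewrite (le_trans (ler_normD _ _))// lerD//.
  have -> : upd i (y i 0) (z y l) = (y i 0 - z y l i 0) *: dir i + z y l.
    move: (z y l) => w.
    by have := upd_shift i (y i 0 - w i 0) (w i 0) w; rewrite subrK upd_id.
  rewrite (le_trans (uC _ _ _))// ler_wpM2l ?C0//.
  exact: leq_trans (ltn_ord i).
have zE y : z y (enum 'I_d) = y.
  apply/colP => i.
  have h l : i \in l -> z y l i 0 = y i 0.
    elim: l => //= j l IHl; rewrite inE; have [->|ij /= il] := eqVneq i j.
      by rewrite upd_eq.
    by rewrite upd_neq// IHl.
  by rewrite h// mem_enum.
have ul y : `|u x - u y| <= `|C| * d%:R * `|x - y|.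
  rewrite distrC -{1}(zE y) (le_trans (uz _ _))// big_enum/= -mulrA.
  rewrite (le_trans (ler_norm _))// normrM ler_wpM2l//.
  rewrite (le_trans (ler_norm_sum _ _ _))//.
  have -> : d%:R * `|x - y| = \sum_(i < d) `|x - y|.
    by rewrite sumr_const card_ord mulr_natl.
  apply: ler_sum => i _; rewrite normr_id distrC.
  by have := norm_coord_le (x - y) i 0; rewrite !mxE.
exact: (@lipschitz_continuous_at _ 'cV[R]_d u x _ ul).
Qed.

Lemma normc_le (a b C : R) : `|a +i* b| <= C%:C -> `|a| <= C /\ `|b| <= C.
Proof.
rewrite normc_def lecR /= => h.
by split; apply: le_trans h; rewrite -sqrtr_sqr ler_wsqrtr// ?lerDl ?lerDr sqr_ge0.
Qed.

Lemma normc_ge (a b C D : R) : `|a| <= C -> `|b| <= D -> `|a +i* b| <= (C + D)%:C.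
Proof.
move=> aC bD; rewrite normc_def lecR /=.
have C0 : 0 <= C by exact: le_trans aC.
have D0 : 0 <= D by exact: le_trans bD.
rewrite -[leRHS]ger0_norm ?addr_ge0// -sqrtr_sqr ler_wsqrtr//.
rewrite -(real_normK (num_real a)) -(real_normK (num_real b)).
have := normr_ge0 a; have := normr_ge0 b; nra.
Qed.

Lemma weighted_partialE a s f x : weighted_partial a s f x =
  (monomial a x * partials s (fun y => complex.Re (f y)) x) +i*
  (monomial a x * partials s (fun y => complex.Im (f y)) x).
Proof.
rewrite /weighted_partial /cpartials -/(monomial a x).
by rewrite -[LHS]/(_ +i* _) !mul0r subr0 addr0.
Qed.

Lemma schwartz_crapid f : schwartz f -> crapid f.
Proof.
move=> [[sR sI] bf]; split; apply: rapidd_of_bounds.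
- by move=> s i x; have [_] := sR s; exact.
- move=> a s; have [C fC] := bf a s; exists C => x.
  by have := fC x; rewrite weighted_partialE => /normc_le[].
- by move=> s i x; have [_] := sI s; exact.
- move=> a s; have [C fC] := bf a s; exists C => x.
  by have := fC x; rewrite weighted_partialE => /normc_le[].
Qed.

Lemma crapid_schwartz f : crapid f -> schwartz f.
Proof.
move=> [rR rI]; split.
  split=> s; split=> [|i x].
  - by apply: rapidd_continuous; exact: rapidd_partials.
  - by apply: rapidd_derivable; exact: rapidd_partials.
  - by apply: rapidd_continuous; exact: rapidd_partials.
  - by apply: rapidd_derivable; exact: rapidd_partials.
move=> a s.
have [C fC] := rapid_bounded (rapidd_monomial a (rapidd_partials s rR)).
have [D fD] := rapid_bounded (rapidd_monomial a (rapidd_partials s rI)).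
by exists (C + D) => x; rewrite weighted_partialE; exact: normc_ge.
Qed.

Lemma monomial_continuous a : continuous (monomial a).
Proof.
elim: a => [|i a IHa].
  rewrite (_ : monomial [::] = cst 1); first exact: cst_continuous.
  by apply/funext => x; rewrite /monomial big_nil.
rewrite (_ : monomial (i :: a) = fun x => x i 0 * monomial a x).
  have ci : continuous (fun x : 'cV[R]_d => x i 0) by exact: coord_continuous.
  by move=> x; exact: (@continuousM R 'cV[R]_d _ _ x (ci x) (IHa x)).
by apply/funext => x; rewrite /monomial big_cons.
Qed.

(** Partial derivatives vanish off the support, and a monomial times a partial
    derivative is continuous, hence bounded, on the compact support. *)
Lemma rapidd_compact_support (D : set 'cV[R]_d) u : compact D -> closed D ->
  smooth_real u -> (forall x, ~ D x -> u x = 0) -> rapidd u.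
Proof.
move=> cD clD su u0.
have p0 s x : ~ D x -> partials s u x = 0.
  elim: s x => [|i s IHs] x Dx; first exact: u0.
  rewrite /= /partial -(derive_cst (0 : R) x (dir i)).
  apply: near_eq_derive.
  have nD : nbhs x (~` D).
    by apply: open_nbhs_nbhs; split => //; exact: closed_openC.
  by apply: filterS nD => y Dy; exact: IHs.
apply: rapidd_of_bounds => [s i x|a s]; first by have [_] := su s; exact.
have cw : continuous (fun x => monomial a x * partials s u x).
  have [cp _] := su s; move=> x.
  exact: (@continuousM R 'cV[R]_d _ _ x (@monomial_continuous a x) (cp x)).
have [M [_ MP]] := compact_bounded (continuous_compact (continuous_subspaceT cw) cD).
exists (`|M| + 1) => x; have [Dx|Dx] := pselect (D x).
  by apply: MP; [rewrite (le_lt_trans (ler_norm _))// ltrDl|exists x].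
by rewrite p0// mulr0 normr0 addr_ge0.
Qed.

Lemma crapid_compact_support (D : set 'cV[R]_d) psi : smooth psi ->
  compact_support_in D psi -> crapid psi.
Proof.
move=> [sR sI] [cK _].
have clK : closed (closure [set x | psi x != 0]) by exact: closed_closure.
have psi0 x : ~ closure [set x | psi x != 0] x -> psi x = 0.
  move=> ncx; apply: contrapT => /eqP px; apply: ncx; exact: subset_closure.
by split; apply: (rapidd_compact_support cK clK) => // x /psi0 ->.
Qed.

End Schwartz.

(** * Distributions with a trigonometric polynomial as Fourier transform *)

Section Comb.
Context {R : realType} {d : nat}.
Implicit Types (c : seq ('cV[int]_d * R[i])).

(** Dirac masses sit at - k because the Fourier transform of the one at - k is
    e^{i k . xi}. *)
Definition comb c (f : 'cV[R]_d -> R[i]) : R[i] :=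
  \sum_(kc <- c) kc.2 * f (- map_mx intr kc.1).

(** Point evaluations are controlled by the seminorm of order 0. *)
Lemma comb_tempered c : tempered (comb c).
Proof.
split=> [a b f g _ _|].
  rewrite /comb !mulr_sumr -big_split; apply: eq_bigr => kc _ /=; ring.
exists (\sum_(kc <- c) complex.Re `|kc.2|), 0%N => f b _ fb.
rewrite /comb (le_trans (ler_norm_sum _ _ _))//.
rewrite mulr_suml rmorph_sum; apply: ler_sum => kc _.
have nE : (complex.Re `|kc.2|)%:C = `|kc.2| by rewrite RRe_real ?normr_real.
rewrite normrM [leRHS](_ : _ = `|kc.2| * b%:C); last first.
  by rewrite rmorphM; congr (_ * _); exact: nE.
rewrite ler_wpM2l//.
have := fb [::] [::] isT isT (- map_mx intr kc.1).
by rewrite /weighted_partial big_nil mul1r /cpartials /=; case: (f _).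
Qed.

Lemma comb_fourier c psi : schwartz psi ->
  comb c (fourier psi) = cintegral (fun xi => trig_poly c xi * psi xi).
Proof. by move=> /schwartz_crapid cpsi; rewrite cintegral_trig_poly. Qed.

Lemma comb_has_fourier c : has_fourier (comb c) (trig_poly c).
Proof. by split=> [|psi]; [exact: comb_tempered|exact: comb_fourier]. Qed.

(** A test function is the Fourier transform of some chi, so g takes on it the
    same value as the combination of Dirac masses with the same Fourier
    transform; these masses lie in Z^d, off the support. *)
Lemma trig_poly_vanishes c (g : ('cV[R]_d -> R[i]) -> R[i]) :
  has_fourier g (trig_poly c) -> vanishes_on (~` int_lattice) g.
Proof.
move=> [_ gF] psi spsi psiL.
have [chi cchi chiE] := fourier_surj (crapid_compact_support spsi psiL).
have schi := crapid_schwartz cchi.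
rewrite -chiE (gF _ schi) -comb_fourier// chiE /comb big1_seq// => kc _.
rewrite (_ : psi _ = 0) ?mulr0//; apply: contrapT => /eqP px.
have [_ /(_ (- map_mx intr kc.1))] := psiL; apply; first exact: subset_closure.
by exists (- kc.1) => //; apply/colP => i; rewrite !mxE rmorphN.
Qed.

End Comb.

(** * The quadratic form and its trigonometric counterpart *)

Lemma le_term_sum (R : realDomainType) (d : nat) (F : 'I_d -> R) (i : 'I_d) :
  (forall j, 0 <= F j) -> F i <= \sum_j F j.
Proof. by move=> F0; rewrite (bigD1 i)//= lerDl sumr_ge0. Qed.

Section Quadratic.
Context {R : realType} {d : nat}.
Variable Q : 'M[R]_d.
Hypothesis Qpd : sym_posdef Q.
Implicit Types (x y xi : 'cV[R]_d).

(** A kernel vector would have zero energy. *)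
Lemma posdef_unit : Q \in unitmx.
Proof.
have [Qsym Qpos] := Qpd.
rewrite -row_free_unit -kermx_eq0; apply/negPn/negP => /rowV0Pn[v vk v0].
have vT0 : v^T != 0.
  by apply: contra v0 => /eqP h; rewrite -[v]trmxK h trmx0.
have := Qpos _ vT0; rewrite trmxK.
by have /sub_kermxP -> := vk; rewrite mul0mx mxE ltxx.
Qed.

Lemma polPE xi : polP Q xi = \sum_i (Q *m xi) i 0 ^+ 2.
Proof.
have [Qsym _] := Qpd; rewrite /polP.
have -> : xi^T *m (Q *m Q) *m xi = (Q *m xi)^T *m (Q *m xi).
  by rewrite trmx_mul Qsym !mulmxA.
by rewrite mxE; apply: eq_bigr => i _; rewrite mxE expr2.
Qed.

Lemma polP_ge0 xi : 0 <= polP Q xi.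
Proof. by rewrite polPE sumr_ge0// => i _; rewrite sqr_ge0. Qed.

Lemma polP_eq0 xi : (polP Q xi == 0) = (xi == 0).
Proof.
apply/eqP/eqP => [|->]; last by rewrite /polP mulmx0 mxE.
rewrite polPE => /eqP; rewrite psumr_eq0 => [/allP h|i _]; last exact: sqr_ge0.
have : Q *m xi = 0.
  apply/colP => i; rewrite [RHS]mxE; apply/eqP.
  by have := h i (mem_index_enum _); rewrite sqrf_eq0.
by move=> /(congr1 (mulmx (invmx Q))); rewrite mulKmx ?posdef_unit// mulmx0.
Qed.

Lemma polP_gt0 xi : xi != 0 -> 0 < polP Q xi.
Proof. by move=> x0; rewrite lt_def polP_eq0 x0 polP_ge0. Qed.

(** The Euclidean norm of Q xi: the norm that A^{-T} contracts by an exact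
    factor. *)
Definition pnorm xi : R := Num.sqrt (polP Q xi).

Lemma pnorm_ge0 xi : 0 <= pnorm xi. Proof. exact: sqrtr_ge0. Qed.

Lemma pnorm_sqr xi : pnorm xi ^+ 2 = polP Q xi.
Proof. by rewrite sqr_sqrtr// polP_ge0. Qed.

Lemma pnorm_gt0 xi : xi != 0 -> 0 < pnorm xi.
Proof. by move=> x0; rewrite sqrtr_gt0 polP_gt0. Qed.

Lemma coord_le_pnorm : exists2 C : R, 0 <= C &
  forall xi i, `|xi i 0| <= C * pnorm xi.
Proof.
pose C := \sum_i \sum_j `|invmx Q i j|.
exists C => [|xi i]; first by apply: sumr_ge0 => i _; exact: sumr_ge0.
rewrite -{1}(mulKmx posdef_unit xi) mxE (le_trans (ler_norm_sum _ _ _))//.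
apply: (@le_trans _ _ ((\sum_j `|invmx Q i j|) * pnorm xi)); last first.
  rewrite ler_wpM2r ?pnorm_ge0//.
  apply: (le_term_sum (F := fun i => \sum_j `|invmx Q i j|)) => k.
  exact: sumr_ge0.
rewrite mulr_suml; apply: ler_sum => j _; rewrite normrM ler_wpM2l//.
rewrite -sqrtr_sqr ler_wsqrtr// polPE.
by apply: (le_term_sum (F := fun i => (Q *m xi) i 0 ^+ 2)) => k; exact: sqr_ge0.
Qed.

Lemma pnorm_le_norm : exists2 C : R, 0 <= C & forall xi, pnorm xi <= C * `|xi|.
Proof.
pose C := \sum_i \sum_j `|Q i j|.
have C0 : 0 <= C by apply: sumr_ge0 => i _; exact: sumr_ge0.
exists C => // xi.
have ci i : `|(Q *m xi) i 0| <= (\sum_j `|Q i j|) * `|xi|.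
  rewrite mxE (le_trans (ler_norm_sum _ _ _))// mulr_suml ler_sum// => j _.
  by rewrite normrM ler_wpM2l// norm_coord_le.
have si (a : 'I_d -> R) : (forall i, 0 <= a i) ->
    \sum_i a i ^+ 2 <= (\sum_i a i) ^+ 2.
  move=> a0; rewrite expr2 mulr_suml ler_sum// => i _.
  by rewrite expr2 ler_wpM2l// le_term_sum.
rewrite /pnorm -[leRHS]ger0_norm ?mulr_ge0// -sqrtr_sqr ler_wsqrtr// polPE.
apply: (@le_trans _ _ (\sum_i ((\sum_j `|Q i j|) * `|xi|) ^+ 2)).
  apply: ler_sum => i _; rewrite -(real_normK (num_real ((Q *m xi) i 0))).
  by rewrite lerXn2r ?nnegrE// mulr_ge0// sumr_ge0.
rewrite /C mulr_suml si// => i.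
by rewrite mulr_ge0// sumr_ge0.
Qed.

Lemma quadratic_split (M : 'M[R]_d) x : M^T = M ->
  (x^T *m M *m x) 0 0 = \sum_i M i i * x i 0 ^+ 2 +
    2 * \sum_(i < d) \sum_(j < d | (i < j)%N) M i j * x i 0 * x j 0.
Proof.
move=> Msym.
have -> : (x^T *m M *m x) 0 0 = \sum_i \sum_j M i j * x i 0 * x j 0.
  rewrite mxE exchange_big /=; apply: eq_bigr => j _.
  by rewrite mxE mulr_suml; apply: eq_bigr => i _; rewrite !mxE; ring.
have -> : \sum_i \sum_j M i j * x i 0 * x j 0 =
    \sum_i (M i i * x i 0 ^+ 2 + (\sum_(j < d | (i < j)%N) M i j * x i 0 * x j 0
     + \sum_(j < d | (j < i)%N) M i j * x i 0 * x j 0)).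
  apply: eq_bigr => i _; rewrite (bigD1 i)//= expr2 mulrA; congr (_ + _).
  rewrite (bigID (fun j : 'I_d => (i < j)%N))/=; congr (_ + _).
    by apply: eq_bigl => j; rewrite -val_eqE; case: ltngtP.
  by apply: eq_bigl => j; rewrite -val_eqE; case: ltngtP.
rewrite !big_split/=; congr (_ + _).
have -> : \sum_(i < d) \sum_(j < d | (j < i)%N) M i j * x i 0 * x j 0 =
    \sum_(i < d) \sum_(j < d | (i < j)%N) M i j * x i 0 * x j 0.
  rewrite (exchange_big_dep predT)//=; apply: eq_bigr => i _.
  apply: eq_bigr => j _; rewrite -{1}Msym mxE; ring.
ring.
Qed.

Lemma QQ_sym : (Q *m Q)^T = Q *m Q.
Proof. by have [Qsym _] := Qpd; rewrite trmx_mul Qsym. Qed.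

Lemma QQ_diag_gt0 i : 0 < (Q *m Q) i i.
Proof.
have di0 : delta_mx i 0 != 0 :> 'cV[R]_d.
  by apply/eqP => /colP/(_ i)/eqP; rewrite !mxE !eqxx oner_eq0.
have := polP_gt0 di0; rewrite /polP trmx_delta -rowE -colE.
by rewrite !mxE.
Qed.

Lemma polP_split x : polP Q x = \sum_i (Q *m Q) i i * x i 0 ^+ 2 +
  2 * \sum_(i < d) \sum_(j < d | (i < j)%N) (Q *m Q) i j * x i 0 * x j 0.
Proof. exact: quadratic_split QQ_sym. Qed.

Lemma cos_half (t : R) : 4 * sin (t / 2) ^+ 2 = 2 - 2 * cos t.
Proof.
rewrite [in RHS](splitr t) cosD -!expr2.
by have := cos2Dsin2 (t / 2); lra.
Qed.

(** Using 4 sin^2(t/2) = sin^2 t + (1 - cos t)^2, G is P at the vector of sines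
    plus a combination of squares with the positive diagonal coefficients of Q^2;
    its sign and its zeros are then visible. *)
Lemma trigG_squares xi : trigG Q xi =
  polP Q (\col_i sin (xi i 0)) + \sum_i (Q *m Q) i i * (1 - cos (xi i 0)) ^+ 2.
Proof.
rewrite polP_split /trigG addrAC; congr (_ + _); last first.
  congr (_ * _); apply: eq_bigr => i _; apply: eq_bigr => j _.
  by rewrite !mxE.
rewrite mulr_sumr -big_split; apply: eq_bigr => i _ /=.
rewrite mulrCA cos_half !mxE -mulrDr; congr (_ * _).
by have := cos2Dsin2 (xi i 0); lra.
Qed.

Lemma trigG_ge0 xi : 0 <= trigG Q xi.
Proof.
rewrite trigG_squares addr_ge0 ?polP_ge0// sumr_ge0// => i _.
by rewrite mulr_ge0 ?sqr_ge0// ltW// QQ_diag_gt0.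
Qed.

(** G and P are the same expression in the values u i and z i j: half-angle sines
    and products of sines for G, half-angles and products of coordinates for P.
    Comparing the two, or G at two points, therefore reduces to comparing those
    values. *)
Lemma quad_diff_bound : exists2 W : R, 0 <= W &
  forall (u v : 'I_d -> R) (z w : 'I_d -> 'I_d -> R) (b : R),
  (forall i, `|u i - v i| <= b) -> (forall i j, `|z i j - w i j| <= b) ->
  `|(4 * (\sum_i (Q *m Q) i i * u i) +
     2 * (\sum_(i < d) \sum_(j < d | (i < j)%N) (Q *m Q) i j * z i j)) -
    (4 * (\sum_i (Q *m Q) i i * v i) +
     2 * (\sum_(i < d) \sum_(j < d | (i < j)%N) (Q *m Q) i j * w i j))|
  <= W * b.
Proof.
exists (4 * (\sum_i `|(Q *m Q) i i|) +
    2 * (\sum_(i < d) \sum_(j < d | (i < j)%N) `|(Q *m Q) i j|)).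
  rewrite addr_ge0// mulr_ge0// sumr_ge0// => i _; exact: sumr_ge0.
move=> u v z w b uv zw.
rewrite opprD addrACA -!mulrBr -!sumrB [leRHS]mulrDl.
rewrite (le_trans (ler_normD _ _))// !normrM [`|4|]ger0_norm// [`|2|]ger0_norm// lerD//.
  rewrite -mulrA ler_wpM2l// mulr_suml (le_trans (ler_norm_sum _ _ _))//.
  by apply: ler_sum => i _; rewrite -mulrBr normrM ler_wpM2l.
rewrite -mulrA ler_wpM2l// mulr_suml (le_trans (ler_norm_sum _ _ _))//.
apply: ler_sum => i _; rewrite -sumrB mulr_suml.
rewrite (le_trans (ler_norm_sum _ _ _))//.
by apply: ler_sum => j _; rewrite -mulrBr normrM ler_wpM2l.
Qed.

Lemma sin_lipschitz (a b : R) : `|sin b - sin a| <= `|b - a|.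
Proof.
rewrite -[leRHS]mul1r; apply: lipschitz_of_derive => s; first exact: derivable_sin.
by have [_ ->] := is_derive_sin s; exact: cos_norm_le1.
Qed.

Lemma cos_lipschitz (a b : R) : `|cos b - cos a| <= `|b - a|.
Proof.
rewrite -[leRHS]mul1r; apply: lipschitz_of_derive => s; first exact: derivable_cos.
by have [_ ->] := is_derive_cos s; rewrite normrN; exact: sin_norm_le1.
Qed.

Lemma sin_abs_le (a : R) : `|sin a| <= `|a|.
Proof. by have := sin_lipschitz 0 a; rewrite sin0 !subr0. Qed.

(** Quadratic instead of cubic, but valid on the whole line and sufficient for a
    cubic bound on G - P. *)
Lemma sin_sub_le (b : R) : `|sin b - b| <= b ^+ 2.
Proof.
wlog b0 : b / 0 <= b => [h|].
  have [/h//|/ltW b0] := leP 0 b.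
  have := h (- b); rewrite oppr_ge0 sinN sqrrN -opprD normrN; exact.
have [c /[!in_itv]/= /andP[c0 cb]] := @MVT_segment _ sin cos 0 b b0
  (fun (x : R) _ => is_derive_sin x) (continuous_subspaceT (@continuous_sin R)).
rewrite sin0 !subr0 => ->.
have -> : cos c * b - b = (cos c - 1) * b by ring.
rewrite normrM (ger0_norm b0) expr2 ler_wpM2r//.
have := cos_lipschitz 0 c; rewrite cos0 subr0 => /le_trans; apply.
by rewrite ger0_norm.
Qed.

Lemma sin_mul_sub_le (a b : R) :
  `|sin a * sin b - a * b| <= `|a| * b ^+ 2 + `|b| * a ^+ 2.
Proof.
have -> : sin a * sin b - a * b = sin a * (sin b - b) + b * (sin a - a) by ring.
rewrite (le_trans (ler_normD _ _))// !normrM lerD//.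
  by rewrite ler_pM// ?sin_abs_le ?sin_sub_le.
by rewrite ler_wpM2l// sin_sub_le.
Qed.

Lemma sin_mul_lipschitz (a b a' b' : R) :
  `|sin a * sin b - sin a' * sin b'| <= `|a - a'| + `|b - b'|.
Proof.
have -> : sin a * sin b - sin a' * sin b' =
  (sin a - sin a') * sin b + (sin b - sin b') * sin a' by ring.
rewrite (le_trans (ler_normD _ _))// lerD//.
  exact: le_mull_bound (sin_lipschitz _ _) (sin_norm_le1 _).
exact: le_mull_bound (sin_lipschitz _ _) (sin_norm_le1 _).
Qed.

Lemma trigGE xi : trigG Q xi =
  4 * (\sum_i (Q *m Q) i i * sin (xi i 0 / 2) ^+ 2) +
  2 * (\sum_(i < d) \sum_(j < d | (i < j)%N)
        (Q *m Q) i j * (sin (xi i 0) * sin (xi j 0))).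
Proof.
by rewrite /trigG; congr (_ + _ * _); apply: eq_bigr => i _;
  apply: eq_bigr => j _; rewrite mulrA.
Qed.

Lemma trigG_lipschitz : exists2 C : R, 0 <= C &
  forall xi a, `|trigG Q (xi + a) - trigG Q a| <= C * pnorm xi.
Proof.
have [C C0 CP] := coord_le_pnorm; have [W W0 WP] := quad_diff_bound.
exists (W * (2 * C)) => [|xi a]; first by rewrite !mulr_ge0.
rewrite !trigGE -mulrA.
apply: WP => [i|i j].
  rewrite !expr2 (le_trans (sin_mul_lipschitz _ _ _ _))//.
  rewrite mxE -mulrBl addrK normrM [`|2^-1|]ger0_norm//.
  by have := CP xi i; have := normr_ge0 (xi i 0); lra.
rewrite (le_trans (sin_mul_lipschitz _ _ _ _))// !mxE !addrK.
by have := CP xi i; have := CP xi j; lra.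
Qed.

(** In every term of G - P a product of two sines replaces the product of the
    arguments, at the cost of a cubic error. *)
Lemma trigG_sub_polP : exists2 C : R, 0 <= C &
  forall xi, `|trigG Q xi - polP Q xi| <= C * pnorm xi ^+ 3.
Proof.
have [C C0 CP] := coord_le_pnorm; have [W W0 WP] := quad_diff_bound.
exists (W * (2 * C ^+ 3)) => [|xi]; first by rewrite !mulr_ge0// exprn_ge0.
have -> : polP Q xi = 4 * (\sum_i (Q *m Q) i i * (xi i 0 / 2) ^+ 2) +
    2 * \sum_(i < d) \sum_(j < d | (i < j)%N) (Q *m Q) i j * (xi i 0 * xi j 0).
  rewrite polP_split mulr_sumr; congr (_ + 2 * _).
    by apply: eq_bigr => i _; field.
  by apply: eq_bigr => i _; apply: eq_bigr => j _; rewrite mulrA.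
rewrite trigGE -mulrA.
have p0 := pnorm_ge0 xi.
have cube i j : `|xi i 0| * xi j 0 ^+ 2 <= C ^+ 3 * pnorm xi ^+ 3.
  rewrite -exprMn [leRHS]exprS -(real_normK (num_real (xi j 0))).
  rewrite ler_pM// ?exprn_ge0// lerXn2r// nnegrE ?mulr_ge0//.
apply: WP => [i|i j].
  rewrite !expr2 (le_trans (sin_mul_sub_le _ _))//.
  have := cube i i; rewrite !normrM [`|2^-1|]ger0_norm// !expr2.
  by have := mulr_ge0 (normr_ge0 (xi i 0)) (sqr_ge0 (xi i 0)); rewrite expr2; lra.
rewrite (le_trans (sin_mul_sub_le _ _))//.
by have := cube i j; have := cube j i; lra.
Qed.

End Quadratic.

(** * Zeros of the trigonometric form *)

Section Lattice.
Context {R : realType}.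

Lemma periodic_int (f : R -> R) (T : R) : periodic f T ->
  forall (k : int) a, f (a + T * k%:~R) = f a.
Proof.
move=> pf [n|n] a; first by rewrite mulr_natr periodicn.
by rewrite NegzE mulrNz mulrN mulr_natr -{2}(subrK (T *+ n.+1) a) periodicn.
Qed.

Lemma cosD_int (a : R) (k : int) : cos (a + 2 * pi * k%:~R) = cos a.
Proof. by rewrite [2 * pi]mulr_natl periodic_int//; exact: cosD2pi. Qed.

Lemma sinD_int (a : R) (k : int) : sin (a + 2 * pi * k%:~R) = sin a.
Proof. by rewrite [2 * pi]mulr_natl periodic_int//; exact: sinD2pi. Qed.

(** Reduce t modulo 2 pi to a remainder in [0, 2 pi); then sin(t/2) = 0 forces the
    remainder to be zero. *)
Lemma cos_eq1 (t : R) : cos t = 1 -> exists k : int, t = 2 * pi * k%:~R.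
Proof.
move=> ct; pose k := Num.floor (t / (2 * pi)); exists k.
have pi0 := @pi_gt0 R.
have p20 : 0 < 2 * pi :> R by rewrite mulr_gt0.
have k1 : 2 * pi * k%:~R <= t by rewrite mulrC -ler_pdivlMr// floor_le_tmp.
have k2 : t < 2 * pi * k%:~R + 2 * pi.
  rewrite -[X in _ + X]mulr1 -mulrDr mulrC -ltr_pdivrMr//.
  by rewrite -[1]/(1%:~R) -intrD floorD1_gt.
have := cosD_int (t - 2 * pi * k%:~R) k; rewrite subrK ct => cr.
have := cos_half (t - 2 * pi * k%:~R); rewrite -cr mulr1 subrr => /eqP.
rewrite mulf_eq0 pnatr_eq0/= sqrf_eq0 => /eqP sr0.
have := ltrP 0 ((t - 2 * pi * k%:~R) / 2) => -[r0|]; last lra.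
have : 0 < sin ((t - 2 * pi * k%:~R) / 2) by rewrite sin_gt0_pi// r0/=; lra.
by rewrite sr0 ltxx.
Qed.

Context {d : nat}.
Variable Q : 'M[R]_d.
Hypothesis Qpd : sym_posdef Q.
Implicit Types (xi : 'cV[R]_d) (k : 'cV[int]_d).

(** The points of 2 pi Z^d. *)
Definition dual_point k : 'cV[R]_d := (2 * pi) *: map_mx intr k.

Lemma trigG_periodic xi k : trigG Q (xi + dual_point k) = trigG Q xi.
Proof.
rewrite !trigG_squares//; congr (polP _ _ + _).
  by apply/colP => i; rewrite !mxE sinD_int.
by apply: eq_bigr => i _; rewrite !mxE cosD_int.
Qed.

Lemma trigG0 : trigG Q 0 = 0.
Proof.
rewrite trigGE big1 => [|i _]; last first.
  by rewrite [in sin _]mxE mul0r sin0 expr0n mulr0.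
rewrite mulr0 add0r big1 ?mulr0// => i _; rewrite big1// => j _.
by rewrite [in sin _]mxE sin0 mul0r mulr0.
Qed.

Lemma trigG_dual_point k : trigG Q (dual_point k) = 0.
Proof. by rewrite -[dual_point k]add0r trigG_periodic trigG0. Qed.

(** Each square in [trigG_squares] vanishes, hence all cosines are 1. *)
Lemma trigG_eq0 xi : trigG Q xi = 0 -> exists k, xi = dual_point k.
Proof.
rewrite trigG_squares// => /eqP.
have q0 i : 0 <= (Q *m Q) i i * (1 - cos (xi i 0)) ^+ 2.
  by rewrite mulr_ge0 ?sqr_ge0// ltW// QQ_diag_gt0.
rewrite paddr_eq0 ?polP_ge0 ?sumr_ge0// => /andP[_].
rewrite psumr_eq0// => /allP h.
have ch i : exists k : int, xi i 0 = 2 * pi * k%:~R.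
  apply: cos_eq1; have := h i (mem_index_enum _).
  rewrite /= mulf_eq0 gt_eqF ?QQ_diag_gt0//= sqrf_eq0 subr_eq0 eq_sym.
  by move/eqP.
have [k kP] := choice ch; exists (\col_i k i).
by apply/colP => i; rewrite !mxE.
Qed.

End Lattice.

(** * Infinite products and punctured limits *)

Section Products.
Context {R : realType}.

Lemma ln_near1 (x : R) : `|x - 1| <= 2^-1 -> `|ln x| <= 2 * `|x - 1|.
Proof.
rewrite ler_norml => /andP[x1 x2].
have x0 : 0 < x by lra.
have h1 : ln x <= x - 1.
  have -> : ln x = ln (1 + (x - 1)) by congr ln; ring.
  by apply: le_ln1Dx; lra.
have h2 : - ln x <= (1 - x) / x.
  rewrite -lnV ?posrE// [X in ln X](_ : _ = 1 + (1 - x) / x); last first.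
    by field; rewrite gt_eqF.
  apply: le_ln1Dx; have -> : (1 - x) / x = x^-1 - 1 by field; rewrite gt_eqF.
  by rewrite ltrBrDr addNr invr_gt0.
have h3 : (1 - x) / x <= 2 * `|x - 1|.
  rewrite ler_pdivrMr//; have [h|h] := leP 0 (x - 1).
    by rewrite ger0_norm//; nra.
  by rewrite ltr0_norm//; nra.
rewrite ler_norml; apply/andP; split; first lra.
by have := ler_norm (x - 1); have := normr_ge0 (x - 1); lra.
Qed.

(** The logarithms are dominated by a geometric series, and the exponential of
    their sum is the limit, which is why it is positive. *)
Lemma cvg_prod_geometric (x : nat -> R) (C r : R) (J : nat) : 0 < r < 1 ->
  (forall n, 0 < x n) ->
  (forall n, (J <= n)%N -> `|x n - 1| <= C * r ^+ n) ->
  exists2 L : R, 0 < L & \prod_(j < n) x j @[n --> \oo] --> L.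
Proof.
move=> /andP[r0 r1] x0 xC.
have C0 : 0 <= C.
  have := le_trans (normr_ge0 _) (xC J (leqnn J)).
  by rewrite pmulr_lge0// exprn_gt0.
have rn n : 0 < r ^+ n by rewrite exprn_gt0.
have [J' JJ' J'P] : exists2 J' : nat, (J <= J')%N &
    forall n, (J' <= n)%N -> C * r ^+ n <= 2^-1.
  have : C * r ^+ n @[n --> \oo] --> C * 0.
    by apply: cvgM; [exact: cvg_cst|apply: cvg_expr; rewrite gtr0_norm].
  rewrite mulr0 => /cvgrPdist_le/(_ 2^-1 ltac:(by []))[N _ NP].
  exists (maxn N J); first exact: leq_maxr.
  move=> n; rewrite geq_max => /andP[Nn Jn]; have := NP n Nn.
  by rewrite /= sub0r normrN ger0_norm// mulr_ge0// ltW.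
(* The second term of K covers the finitely many factors before J', so that
   the bound holds from the first index on. *)
pose K := 2 * C + \sum_(i < J') `|ln (x i)| / r ^+ i.
have lnKr n : `|ln (x n)| <= K * r ^+ n.
  have s0 : 0 <= \sum_(i < J') `|ln (x i)| / r ^+ i.
    by apply: sumr_ge0 => i _; rewrite divr_ge0// ltW.
  have [nJ|Jn] := ltnP n J'.
    rewrite -ler_pdivrMr// /K ler_wpDl ?mulr_ge0//.
    rewrite (bigD1 (Ordinal nJ))//= lerDl sumr_ge0// => i _.
    by rewrite divr_ge0// ltW.
  have h := xC n (leq_trans JJ' Jn).
  rewrite (le_trans (ln_near1 (le_trans h (J'P n Jn))))//.
  apply: (@le_trans _ _ (2 * C * r ^+ n)); first by rewrite -mulrA ler_wpM2l.
  by rewrite ler_wpM2r ?(ltW (rn n))// /K lerDl.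
have cs : cvgn (series (fun n => ln (x n))).
  apply: normed_cvg; apply: (@series_le_cvg _ _ (fun n => K * r ^+ n)) => //.
  - by move=> n /=.
  - by move=> n; rewrite (le_trans _ (lnKr n)).
  - by apply: is_cvg_geometric_series; rewrite gtr0_norm.
exists (expR (lim (series (fun n => ln (x n)) @ \oo))); first exact: expR_gt0.
have -> : (fun n => \prod_(j < n) x j) =
    fun n => expR (series (fun n => ln (x n)) n).
  apply/funext => n; rewrite /series /= expR_sum big_mkord.
  by apply: eq_bigr => i _; rewrite lnK ?posrE.
by apply: continuous_cvg => //; exact: continuous_expR.
Qed.

(** Lipschitz-type bounds are what the estimates near the origin provide. *)
Lemma cvg_dnbhs_lipschitz (V : normedModType R) (f : V -> R) (x : V) (l C e : R) :
  0 < e -> (forall y, y != x -> `|y - x| <= e -> `|f y - l| <= C * `|y - x|) ->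
  f y @[y --> x^'] --> l.
Proof.
move=> e0 fC; apply/cvgrPdist_le => eps eps0.
have k0 : 0 < `|C| + 1 by rewrite ltr_wpDl.
apply/nbhs_normP; exists (Num.min e (eps / (`|C| + 1))).
  by rewrite /= lt_min e0 divr_gt0.
move=> y; rewrite /ball_ /= lt_min => /andP[xe]; rewrite ltr_pdivlMr// => xeps yx.
rewrite distrC in xe xeps; rewrite distrC (le_trans (fC _ yx (ltW xe)))//.
rewrite (le_trans _ (ltW xeps))// mulrC ler_wpM2l//.
by rewrite (le_trans (ler_norm _))// lerDl.
Qed.

Lemma dnbhs_proper (V : normedModType R) (x v : V) : v != 0 -> ProperFilter x^'.
Proof.
move=> v0; apply: Build_ProperFilter => /nbhs_normP[e /= e0 eP].
have nv : 0 < `|v| by rewrite normr_gt0.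
pose h := e / 2 / `|v|.
have h0 : 0 < h by rewrite !divr_gt0.
apply: (eP (x + h *: v)).
  rewrite /ball_ /= opprD addNKr normrN normrZ gtr0_norm// /h divfK ?gt_eqF//.
  lra.
by rewrite -subr_eq0 [x + _]addrC addrK scaler_eq0 negb_or v0 gt_eqF.
Qed.

End Products.

(** * Functions tending to one at the origin *)

Section Near.
Context {R : realType} {d : nat}.
Variable Q : 'M[R]_d.
Hypothesis Qpd : sym_posdef Q.
Implicit Types (xi : 'cV[R]_d) (f g : 'cV[R]_d -> R).
Local Notation p := (pnorm Q).

(** f = 1 + O(sqrt P) at the origin, the origin itself excluded.  The class is
    closed under products, inverses and precomposition with A^{-T}, and such f
    give convergent products along the orbits of A^{-T}. *)
Definition near_one f := exists C e : R, [/\ 0 <= C, 0 < e &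
  forall xi, xi != 0 -> p xi <= e -> `|f xi - 1| <= C * p xi].

Lemma near_one_mul f g : near_one f -> near_one g ->
  near_one (fun xi => f xi * g xi).
Proof.
move=> [C [e [C0 e0 fC]]] [D [e' [D0 e'0 gD]]].
exists (C * (1 + D) + D), (Num.min 1 (Num.min e e')).
rewrite !lt_min e0 e'0 ltr01; split => //.
  by rewrite addr_ge0// mulr_ge0// addr_ge0.
move=> xi x0; rewrite !le_min => /and3P[p1 pe pe'].
have := fC _ x0 pe; have := gD _ x0 pe'; have p0 := pnorm_ge0 Q xi.
have -> : f xi * g xi - 1 = (f xi - 1) * (1 + (g xi - 1)) + (g xi - 1) by ring.
move: (f xi - 1) (g xi - 1) => a b bD aC.
rewrite (le_trans (ler_normD _ _))// normrM mulrDl lerD// -mulrA.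
rewrite [_ * p xi]mulrC mulrA ler_pM// (le_trans (ler_normD _ _))// normr1 lerD//.
by rewrite (le_trans bD)// ler_piMr.
Qed.

(** On the smaller radius f is at least 1/2, which accounts for the factor 2 in
    the new constant. *)
Lemma near_one_inv f : near_one f -> near_one (fun xi => (f xi)^-1).
Proof.
move=> [C [e [C0 e0 fC]]].
have k0 : 0 < 2 * C + 1 by rewrite ltr_wpDl// mulr_ge0.
exists (2 * C), (Num.min e (2 * C + 1)^-1).
rewrite lt_min e0 invr_gt0 k0; split => //; first by rewrite mulr_ge0.
move=> xi x0; rewrite le_min => /andP[pe pk].
have := fC _ x0 pe; have p0 := pnorm_ge0 Q xi.
have Cp : C * p xi <= 2^-1.
  have : (2 * C + 1) * p xi <= 1 by rewrite mulrC -ler_pdivlMr// mul1r.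
  by lra.
move=> h; have f12 : 2^-1 <= f xi.
  by move: (le_trans h Cp); rewrite ler_norml => /andP[]; lra.
have f0 : 0 < f xi by rewrite (lt_le_trans _ f12).
have -> : (f xi)^-1 - 1 = - ((f xi - 1) / f xi) by field; rewrite gt_eqF.
rewrite normrN normrM normfV (gtr0_norm f0) ler_pdivrMr// (le_trans h)//.
have : 0 <= C * p xi by rewrite mulr_ge0.
by nra.
Qed.

Lemma near_one_cst1 : near_one (fun=> 1).
Proof. by exists 0, 1; split=> // xi _ _; rewrite subrr normr0 mul0r. Qed.

Lemma near_one_prod (T : eqType) (r : seq T) (F : T -> 'cV[R]_d -> R) :
  (forall s, s \in r -> near_one (F s)) ->
  near_one (fun xi => \prod_(s <- r) F s xi).
Proof.
elim: r => [_|s r IHr nF].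
  by under eq_fun do rewrite big_nil; exact: near_one_cst1.
under eq_fun do rewrite big_cons; apply: near_one_mul.
  by apply: nF; rewrite mem_head.
by apply: IHr => t tr; apply: nF; rewrite inE tr orbT.
Qed.

Lemma near_one_GP : near_one (fun xi => trigG Q xi / polP Q xi).
Proof.
have [C C0 CP] := trigG_sub_polP Qpd.
exists C, 1; split => // xi x0 _.
have P0 := polP_gt0 Qpd x0; have p0 := pnorm_gt0 Qpd x0.
have -> : trigG Q xi / polP Q xi - 1 = (trigG Q xi - polP Q xi) / polP Q xi.
  by field; rewrite gt_eqF.
rewrite normrM normfV (gtr0_norm P0) ler_pdivrMr//.
by rewrite (le_trans (CP xi))// -(pnorm_sqr Qpd) -mulrA -exprS.
Qed.

(** The individual factors of the mask. *)
Lemma near_one_shift a : trigG Q a != 0 ->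
  near_one (fun xi => trigG Q (xi + a) / trigG Q a).
Proof.
move=> Ga; have [C C0 CP] := trigG_lipschitz Qpd.
exists (C / `|trigG Q a|), 1; split => // [|xi _ _]; first by rewrite divr_ge0.
have -> : trigG Q (xi + a) / trigG Q a - 1 =
  (trigG Q (xi + a) - trigG Q a) / trigG Q a by field.
by rewrite normrM normfV mulrAC ler_wpM2r ?invr_ge0.
Qed.

End Near.

(** * The mask, mu and their infinite products *)

Section Dilation.
Context {R : realType} {d : nat}.
Hypothesis d0 : (0 < d)%N.
Variable A : 'M[int]_d.
Hypothesis hA : isotropic_dilation (R := R) A.
Variable Q : 'M[R]_d.
Hypothesis hQ : factors A Q.
Implicit Types (xi eta s : 'cV[R]_d) (k : 'cV[int]_d).

(** The determinant is the product of the d >= 1 eigenvalues, all larger than 1 in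
    modulus. *)
Lemma dilation_index_gt1 : (1 < dilation_index A)%N.
Proof.
have [hev _ _] := hA; pose AC : 'M[R[i]]_d := map_mx intr A.
have [r pE] := closed_field_poly_normal (char_poly AC).
rewrite (monicP (char_poly_monic AC)) scale1r in pE.
have sr : size r = d.
  by apply: succn_inj; rewrite -(size_prod_XsubC r id) -pE size_char_poly.
have rgt1 z : z \in r -> 1 < `|z|.
  by move=> zr; apply: hev; rewrite eigenvalue_root_char pE root_prod_XsubC.
have detE : `|\det AC| = \prod_(z <- r) `|z|.
  have := char_poly_det AC; rewrite pE -horner_coef0 horner_prod => /(congr1 Num.norm).
  rewrite normrM normrX normrN1 expr1n mul1r normr_prod => <-.
  by apply: eq_bigr => z _; rewrite !hornerE normrN.
have : 1 < `|\det AC|.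
  rewrite detE; move: sr rgt1 => {pE detE}; case: r => [|z r] sz rgt1.
    by move: d0; rewrite -sz.
  rewrite big_cons; apply: (@lt_le_trans _ _ `|z|); first by rewrite rgt1// mem_head.
  rewrite ler_peMr// big_seq; elim/big_rec: _ => // y x yr IH.
  by rewrite mulr_ege1// ltW// rgt1// inE yr orbT.
by rewrite /AC det_map_mx -intr_norm -[1]/(1%:~R) ltr_int /dilation_index -abszE.
Qed.

Local Notation q := (dilation_index A).
Local Notation AT := (matrix_over_R A : 'M[R]_d)^T.
Local Notation B := (inv_tr A : 'M[R]_d).

Let Qpd : sym_posdef Q. Proof. by case: hQ. Qed.

Lemma AT_unit : AT \in unitmx.
Proof.
rewrite unitmx_tr unitmxE unitfE det_map_mx intr_eq0 -absz_eq0.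
by rewrite -lt0n (ltn_trans _ dilation_index_gt1).
Qed.

Lemma mulATB xi : AT *m (B *m xi) = xi.
Proof. by rewrite mulKVmx// AT_unit. Qed.

Lemma mulBAT xi : B *m (AT *m xi) = xi.
Proof. by rewrite mulKmx// AT_unit. Qed.

Definition contraction : R := q%:R `^ (- d%:R^-1).

Lemma q_gt1 : 1 < q%:R :> R.
Proof. by rewrite ltr1n dilation_index_gt1. Qed.

Lemma contraction_itv : 0 < contraction < 1.
Proof.
have q0 : q%:R != 0 :> R by rewrite gt_eqF// (lt_trans ltr01 q_gt1).
rewrite powR_gt0 ?(lt_trans ltr01 q_gt1)//= /contraction /powR (negbTE q0).
by rewrite expR_lt1 mulNr oppr_lt0 mulr_gt0 ?invr_gt0 ?ltr0n// ln_gt0// q_gt1.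
Qed.

Lemma contraction_sqr : q%:R `^ (2 / d%:R) * contraction ^+ 2 = 1.
Proof.
have q0 : q%:R != 0 :> R by rewrite gt_eqF// (lt_trans ltr01 q_gt1).
rewrite /contraction -powR_mulrn ?powR_ge0// -powRrM -powRD; last first.
  by rewrite q0 implybT.
by rewrite mulNr mulrC addrN powRr0.
Qed.

(** Q A^{-T} = q^{-1/d} U Q with U orthogonal. *)
Lemma polP_inv_tr xi : polP Q (B *m xi) = contraction ^+ 2 * polP Q xi.
Proof.
have [_ [U Uo BE]] := hQ.
have QB : Q *m (B *m xi) = contraction *: (U *m (Q *m xi)).
  by rewrite BE -scalemxAl -scalemxAr -!mulmxA mulKVmx ?posdef_unit.
have PE (z : 'cV[R]_d) : polP Q z = ((Q *m z)^T *m (Q *m z)) 0 0.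
  by have [Qsym _] := Qpd; rewrite /polP trmx_mul Qsym !mulmxA.
have sqZ (z : 'cV[R]_d) : ((contraction *: z)^T *m (contraction *: z)) 0 0 =
    contraction ^+ 2 * (z^T *m z) 0 0.
  by rewrite !mxE mulr_sumr; apply: eq_bigr => i _; rewrite !mxE; ring.
by rewrite !PE QB sqZ trmx_mul -mulmxA (mulmxA U^T) Uo mul1mx.
Qed.

Lemma pnorm_inv_tr xi : pnorm Q (B *m xi) = contraction * pnorm Q xi.
Proof.
have /andP[c0 _] := contraction_itv.
by rewrite /pnorm polP_inv_tr sqrtrM ?sqr_ge0// sqrtr_sqr gtr0_norm.
Qed.

Lemma inv_tr_eq0 xi : (B *m xi == 0) = (xi == 0).
Proof.
apply/eqP/eqP => [h|->]; last by rewrite mulmx0.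
by rewrite -(mulATB xi) h mulmx0.
Qed.

Lemma near_one_inv_tr f : near_one Q f -> near_one Q (fun xi => f (B *m xi)).
Proof.
have /andP[c0 c1] := contraction_itv.
move=> [C [e [C0 e0 fC]]]; exists C, e; split => // xi x0 pe.
have pB : pnorm Q (B *m xi) <= pnorm Q xi.
  by rewrite pnorm_inv_tr ler_piMl ?pnorm_ge0// ltW.
rewrite (le_trans (fC _ _ (le_trans pB pe))) ?inv_tr_eq0//.
by rewrite ler_wpM2l.
Qed.

Local Notation emb := (map_mx intr : 'cV[int]_d -> 'cV[R]_d).

Lemma digits0 : digits A (0 : 'cV[R]_d).
Proof.
split=> [i|]; first by rewrite mxE lexx ltr01.
by exists 0 => //; rewrite mulmx0; apply/colP => i; rewrite !mxE.
Qed.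

(** For a digit s, the integer vector A^T s is bounded entrywise by the sum of the
    absolute values of the entries of A; so only finitely many are possible. *)
Lemma digits_seq : exists r : seq 'cV[R]_d,
  uniq r /\ (forall s, s \in r <-> digits A s).
Proof.
pose N := (\sum_i \sum_j `|A i j|)%N.
(* Integer vectors with entries in [-N, N], shifted by N into ordinals. *)
pose F (m : {ffun 'I_d -> 'I_(2 * N).+1}) : 'cV[R]_d :=
  B *m \col_i ((m i)%:R - N%:R).
exists [seq s <- undup (codom F) | `[< digits A s >]].
split=> [|s]; first by rewrite filter_uniq// undup_uniq.
rewrite mem_filter mem_undup; split=> [/andP[/asboolP//]|ds].
apply/andP; split; first exact/asboolP.
have [s01 [k _ kE]] := ds.
have kN i : (absz (k i 0%R) <= N)%N.
  have : `|(k i 0)%:~R : R| <= N%:R.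
    have -> : (k i 0)%:~R = (AT *m s) i 0 by rewrite -kE mxE.
    rewrite mxE (le_trans (ler_norm_sum _ _ _))//.
    have -> : N%:R = \sum_i \sum_j `|(A i j)%:~R| :> R.
      rewrite /N natr_sum; apply: eq_bigr => a _; rewrite natr_sum.
      by apply: eq_bigr => b _; rewrite natr_absz intr_norm.
    rewrite exchange_big /=.
    apply: (@le_trans _ _ (\sum_j `|(A j i)%:~R|)); last first.
      apply: (le_term_sum (F := fun i => \sum_j `|(A j i)%:~R|)) => a.
      exact: sumr_ge0.
    apply: ler_sum => j _; rewrite !mxE normrM ler_piMr//.
    by have /andP[sj0 sj1] := s01 j; rewrite ger0_norm// ltW.
  by rewrite -intr_norm -natr_absz ler_nat.
apply/codomP; exists [ffun i => inord (absz (k i 0 + N%:Z))].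
rewrite /F -[LHS](mulBAT s) -kE; congr (_ *m _); apply/colP => i.
rewrite !mxE ffunE inordK; last first.
  by have := kN i; lia.
have -> : (`|(k i 0 + N)%R|%N)%:R = (k i 0)%:~R + N%:R :> R.
  have h : 0 <= k i 0 + N%:Z by have := kN i; lia.
  by rewrite natr_absz ger0_norm// intrD.
by rewrite addrK.
Qed.

Lemma dual_pointD (k l : 'cV[int]_d) :
  dual_point (k + l) = dual_point k + dual_point l :> 'cV[R]_d.
Proof. by apply/colP => i; rewrite !mxE intrD mulrDr. Qed.

Lemma dual_pointN k : dual_point (- k) = - dual_point k :> 'cV[R]_d.
Proof. by apply/colP => i; rewrite !mxE rmorphN mulrN. Qed.

Lemma AT_dual_point k : AT *m dual_point k = dual_point (A^T *m k).
Proof.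
rewrite /dual_point -scalemxAr; congr (_ *: _).
by rewrite map_mxM map_trmx.
Qed.

Variable r : seq 'cV[R]_d.
Hypothesis r_uniq : uniq r.
Hypothesis rP : forall s, s \in r <-> digits A s.

(** The index set of the mask. *)
Definition nonzero_digits := [seq s <- r | s != 0].

Lemma elliptic_mask_prod xi : elliptic_mask A Q xi =
  \prod_(s <- nonzero_digits)
    (trigG Q (xi + (2 * pi) *: s) / trigG Q ((2 * pi) *: s)).
Proof.
rewrite fsbig_seq; last exact: filter_uniq.
have E : digits A `\ 0 = [set` nonzero_digits].
  apply/seteqP; split => s /=; rewrite mem_filter.
    by move=> [/rP sr /eqP s0]; rewrite sr s0.
  by move=> /andP[s0 /rP sr]; split => //; exact/eqP.
by rewrite /elliptic_mask E.
Qed.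

Lemma digit_dual_point s k : digits A s -> (2 * pi) *: s = dual_point k -> s = 0.
Proof.
move=> [s01 _] /(congr1 (fun v => (2 * pi)^-1 *: v)).
have p0 : 2 * pi != 0 :> R by rewrite mulf_neq0// gt_eqF// pi_gt0.
rewrite /dual_point !scalerA mulVf// !scale1r => sk; apply/colP => i.
have := s01 i; rewrite sk !mxE -[1]/(1%:~R) -[0 <= _]/(0%:~R <= _) ler_int ltr_int.
by move=> ki; have -> : k i 0 = 0 by lia.
Qed.

Lemma trigG_digit_gt0 s : s \in nonzero_digits -> 0 < trigG Q ((2 * pi) *: s).
Proof.
rewrite mem_filter => /andP[s0 /rP ds]; rewrite lt_def trigG_ge0// andbT.
apply/eqP => /(trigG_eq0 Qpd)[k /(digit_dual_point ds)].
by move/eqP; rewrite (negbTE s0).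
Qed.

(** Including s = 0 in the product over digits multiplies the mask by G: this
    symmetric product is the one with a translation invariance. *)
Definition coset_prod eta : R := \prod_(s <- r) trigG Q (eta + (2 * pi) *: s).
Definition coset_cst : R := \prod_(s <- nonzero_digits) trigG Q ((2 * pi) *: s).

Lemma coset_cst_gt0 : 0 < coset_cst.
Proof.
rewrite /coset_cst big_seq; apply: prodr_gt0 => s; exact: trigG_digit_gt0.
Qed.

Lemma coset_prodE eta :
  elliptic_mask A Q eta * trigG Q eta = coset_prod eta / coset_cst.
Proof.
have r0 : 0 \in r by apply/rP; exact: digits0.
rewrite elliptic_mask_prod prodf_div mulrAC; congr (_ / _).
rewrite /coset_prod [RHS](bigD1_seq 0)//= scaler0 addr0 mulrC; congr (_ * _).
by rewrite big_filter.
Qed.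

(** The representative of s modulo Z^d in the unit cube. *)
Definition frac s : 'cV[R]_d := \col_i (s i 0 - (Num.floor (s i 0))%:~R).

Lemma frac_digit s : int_lattice (AT *m s) -> digits A (frac s).
Proof.
move=> [k _ kE]; split=> [i|].
  rewrite mxE subr_ge0 floor_le_tmp/= ltrBlDl.
  by have := floorD1_gt (s i 0); rewrite intrD.
exists (k - A^T *m \col_i Num.floor (s i 0)) => //.
have -> : frac s = s - emb (\col_i Num.floor (s i 0)).
  by apply/colP => i; rewrite !mxE.
by rewrite mulmxBr -kE map_mxB map_mxM map_trmx.
Qed.

Lemma trigG_frac eta s :
  trigG Q (eta + (2 * pi) *: frac s) = trigG Q (eta + (2 * pi) *: s).
Proof.
rewrite -(trigG_periodic Qpd _ (\col_i Num.floor (s i 0))); congr trigG.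
by apply/colP => i; rewrite !mxE; ring.
Qed.

(** Adding B k to the digits and reducing modulo Z^d permutes the digits, and G
    only depends on its argument modulo 2 pi Z^d. *)
Lemma coset_prod_periodic eta k :
  coset_prod (eta + B *m dual_point k) = coset_prod eta.
Proof.
pose tau s := frac (B *m emb k + s).
have tauP s : digits A s -> digits A (tau s).
  move=> [_ [l _ lE]]; apply: frac_digit; exists (k + l) => //.
  by rewrite mulmxDr mulATB -lE map_mxD.
have tau_inj : {in r &, injective tau}.
  move=> s s' /rP[s01 _] /rP[s'01 _] /colP tE; apply/colP => i.
  have := tE i; rewrite !mxE.
  set a := Num.floor _; set b := Num.floor _ => e.
  have {}e : s i 0 - s' i 0 = (a - b)%:~R by rewrite intrB; lra.
  have /andP[x1 x2] := s01 i; have /andP[y1 y2] := s'01 i.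
  have h1 : (a - b)%:~R < 1%:~R :> R by rewrite -e; lra.
  have h2 : (-1)%:~R < (a - b)%:~R :> R by rewrite -e; lra.
  move: h1 h2; rewrite !ltr_int => h1 h2.
  have ab : a - b = 0 by lia.
  by move: e; rewrite ab; lra.
(* An injection of the finite set of digits into itself. *)
have tau_perm : perm_eq (map tau r) r.
  have um : uniq (map tau r) by rewrite map_inj_in_uniq.
  have sub : {subset map tau r <= r}.
    by move=> _ /mapP[s /rP sr ->]; apply/rP; exact: tauP.
  have [_ mE] := uniq_min_size um sub (eq_leq (esym (size_map _ _))).
  exact: uniq_perm.
rewrite /coset_prod -[RHS](perm_big _ tau_perm)/= big_map.
apply: eq_bigr => s _; rewrite /tau trigG_frac; congr trigG.
by rewrite /dual_point -scalemxAr scalerDr addrA.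
Qed.

Lemma coset_prod_lattice k : coset_prod (B *m dual_point k) = 0.
Proof.
have := coset_prod_periodic 0 k; rewrite add0r => ->.
have r0 : 0 \in r by apply/rP; exact: digits0.
by rewrite /coset_prod (bigD1_seq 0)//= scaler0 addr0 trigG0// mul0r.
Qed.

(** If G vanished at B xi + 2 pi s, applying A^T would put xi in 2 pi Z^d. *)
Lemma coset_prod_gt0 xi : trigG Q xi != 0 -> 0 < coset_prod (B *m xi).
Proof.
move=> G0; rewrite /coset_prod big_seq; apply: prodr_gt0 => s /rP[_ [l _ lE]].
rewrite lt_def trigG_ge0// andbT; apply: contra G0 => /eqP.
move=> /(trigG_eq0 Qpd)[k /(congr1 (mulmx AT))].
rewrite mulmxDr mulATB AT_dual_point -scalemxAr -lE -/(dual_point l) => e.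
have -> : xi = dual_point (A^T *m k - l).
  by rewrite dual_pointD dual_pointN -e addrK.
by rewrite trigG_dual_point.
Qed.

Lemma mu_quotE xi : mu_quot A Q xi =
  q%:R `^ (2 / d%:R) * (coset_prod (B *m xi) / coset_cst) / trigG Q xi.
Proof. by rewrite /mu_quot -(mulrA (_ `^ _)) coset_prodE. Qed.

Lemma mu_quot_periodic xi k : mu_quot A Q (xi + dual_point k) = mu_quot A Q xi.
Proof. by rewrite !mu_quotE mulmxDr coset_prod_periodic trigG_periodic. Qed.

Lemma near_one_mask : near_one Q (elliptic_mask A Q).
Proof.
have -> : elliptic_mask A Q = fun xi => \prod_(s <- nonzero_digits)
    (trigG Q (xi + (2 * pi) *: s) / trigG Q ((2 * pi) *: s)).
  by apply/funext => xi; exact: elliptic_mask_prod.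
apply: near_one_prod => s sr; apply: near_one_shift => //.
by rewrite gt_eqF// trigG_digit_gt0.
Qed.

(** q^{2/d} is P(xi) / P(B xi), so the quotient is the mask at B xi times the
    ratio of G / P at B xi and at xi; all these tend to one. *)
Lemma near_one_mu_quot : near_one Q (mu_quot A Q).
Proof.
have nG := near_one_GP Qpd.
have := near_one_mul (near_one_inv_tr near_one_mask)
  (near_one_mul (near_one_inv_tr nG) (near_one_inv nG)).
move=> [C [e [C0 e0 CP]]]; exists C, e; split => // xi x0 pe.
have := CP xi x0 pe; congr (`|_ - 1| <= _).
have P0 := polP_gt0 Qpd x0; have /andP[c0 _] := contraction_itv.
rewrite polP_inv_tr /mu_quot invf_div.
have -> : q%:R `^ (2 / d%:R) = (contraction ^+ 2)^-1.
  apply: (mulIf (expf_neq0 2 (lt0r_neq0 c0))).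
  by rewrite contraction_sqr mulVf// expf_neq0// lt0r_neq0.
move: (trigG Q xi)^-1 (polP Q xi) P0 contraction c0 => g P P0 c c0.
by field; rewrite !gt_eqF.
Qed.

(** By periodicity the limit at a lattice point is the limit at the origin. *)
Lemma mu_lattice xi : trigG Q xi = 0 -> mu A Q xi = 1.
Proof.
move=> G0; rewrite /mu G0 eqxx.
have [k xiE] := trigG_eq0 Qpd G0.
have [C [e [C0 e0 CP]]] := near_one_mu_quot.
have [L L0 LP] := pnorm_le_norm Qpd.
(* In positive dimension a punctured neighbourhood is never empty. *)
have v0 : (const_mx 1 : 'cV[R]_d) != 0.
  by apply/eqP => /colP/(_ (Ordinal d0))/eqP; rewrite !mxE oner_eq0.
have pf := dnbhs_proper xi v0.
apply: (@cvg_lim R (@norm_hausdorff _ _) _ _ pf).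
apply: (@cvg_dnbhs_lipschitz R 'cV[R]_d (mu_quot A Q) xi 1 (C * L) (e / (L + 1))).
  by rewrite divr_gt0// ltr_wpDl.
move=> y yx ye; have -> : mu_quot A Q y = mu_quot A Q (y - xi).
  by rewrite xiE -dual_pointN mu_quot_periodic.
have yx0 : y - xi != 0 by rewrite subr_eq0.
have pe : pnorm Q (y - xi) <= e.
  rewrite (le_trans (LP _))//.
  move: ye; rewrite ler_pdivlMr ?ltr_wpDl// => ye.
  by rewrite (le_trans _ ye)// mulrC ler_wpM2l// lerDl.
by rewrite (le_trans (CP _ yx0 pe))// -mulrA ler_wpM2l.
Qed.

Lemma mu_nonlattice xi : trigG Q xi != 0 -> mu A Q xi = mu_quot A Q xi.
Proof. by rewrite /mu => /negbTE ->. Qed.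

Lemma mu_gt0 xi : 0 < mu A Q xi.
Proof.
have [/eqP G0|G0] := boolP (trigG Q xi == 0); first by rewrite mu_lattice.
have Gp : 0 < trigG Q xi by rewrite lt_def G0 trigG_ge0.
rewrite mu_nonlattice// mu_quotE divr_gt0// mulr_gt0//.
  by rewrite powR_gt0// (lt_trans ltr01 q_gt1).
by rewrite divr_gt0 ?coset_prod_gt0// coset_cst_gt0.
Qed.

Lemma near_one_mu : near_one Q (mu A Q).
Proof.
have [C [e [C0 e0 CP]]] := near_one_mu_quot; exists C, e; split => // xi x0 pe.
have [/eqP G0|G0] := boolP (trigG Q xi == 0).
  by rewrite mu_lattice// subrr normr0 mulr_ge0// pnorm_ge0.
by rewrite mu_nonlattice// CP.
Qed.

(** Off the lattice this defines mu; on it G and the coset product both vanish. *)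
Lemma mask_refinement xi :
  q%:R `^ (2 / d%:R) * (elliptic_mask A Q (B *m xi) * trigG Q (B *m xi)) =
  mu A Q xi * trigG Q xi.
Proof.
have [/eqP G0|G0] := boolP (trigG Q xi == 0); last first.
  by rewrite mu_nonlattice// /mu_quot divfK// mulrA.
have [k ->] := trigG_eq0 Qpd G0.
by rewrite trigG_dual_point// mulr0 coset_prodE coset_prod_lattice mul0r mulr0.
Qed.

Local Notation it n xi := (iter n (mulmx B) xi).

Lemma pnorm_iter n xi : pnorm Q (it n xi) = contraction ^+ n * pnorm Q xi.
Proof.
elim: n => [|n IHn]; first by rewrite mul1r.
by rewrite iterS pnorm_inv_tr IHn exprS mulrA.
Qed.

Lemma iter_neq0 n xi : xi != 0 -> it n xi != 0.
Proof. by move=> x0; elim: n => //= n IHn; rewrite inv_tr_eq0. Qed.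

Lemma mask_prod_telescope n xi :
  (\prod_(1 <= j < n.+1) elliptic_mask A Q (it j xi)) *
    ((q%:R `^ (2 / d%:R)) ^+ n * trigG Q (it n xi)) =
  (\prod_(j < n) mu A Q (it j xi)) * trigG Q xi.
Proof.
elim: n => [|n IHn]; first by rewrite big_geq// big_ord0 !mul1r.
rewrite big_nat_recr//= big_ord_recr/= exprS.
have := mask_refinement (it n xi); move: IHn; rewrite /=.
move: (\prod_(1 <= j < n.+1) _) (\prod_(j < n) _) (mu A Q (it n xi)) => u v w.
move: (elliptic_mask _ _ _) (trigG Q (it n xi)) (trigG Q (B *m _)) => m g h.
move: (_ `^ _) => l IHn e.
transitivity (u * l ^+ n * (l * (m * h))); first by ring.
rewrite e; transitivity (u * (l ^+ n * g) * w); first by ring.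
by rewrite IHn mulrAC.
Qed.

Lemma prodM_cvg xi : xi != 0 -> exists2 L : R, 0 < L &
  \prod_(j < n) mu A Q (it j xi) @[n --> \oo] --> L.
Proof.
move=> x0; have [C [e [C0 e0 CP]]] := near_one_mu.
have /andP[c0 c1] := contraction_itv.
have p0 := pnorm_gt0 Qpd x0.
have : contraction ^+ n * pnorm Q xi @[n --> \oo] --> 0 * pnorm Q xi.
  by apply: cvgM; [apply: cvg_expr; rewrite gtr0_norm|exact: cvg_cst].
rewrite mul0r => /cvgrPdist_le/(_ e e0)[J _ JP].
apply: (@cvg_prod_geometric _ (fun n => mu A Q (it n xi))
  (C * pnorm Q xi) contraction J).
- by rewrite c0.
- by move=> n; exact: mu_gt0.
- move=> n Jn; have := JP n Jn; rewrite /= sub0r normrN ger0_norm; last first.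
    by rewrite mulr_ge0 ?exprn_ge0 ?(ltW c0) ?(ltW p0).
  move=> pe; rewrite (le_trans (CP _ (iter_neq0 n x0) _)) ?pnorm_iter//.
  by rewrite mulrA mulrAC.
Qed.

Lemma prodM_gt0 xi : xi != 0 -> 0 < prodM A Q xi.
Proof.
by move=> /prodM_cvg[L L0 Lcvg]; rewrite /prodM (cvg_lim _ Lcvg).
Qed.

(** Divide the telescoped identity by q^{2n/d} G(B^n xi), which equals P(xi) times
    G / P at B^n xi and so tends to P(xi). *)
Lemma phi_hatE xi : xi != 0 ->
  phi_hat A Q xi = trigG Q xi * (prodM A Q xi / polP Q xi).
Proof.
move=> x0; have [L L0 Lcvg] := prodM_cvg x0.
rewrite /prodM (cvg_lim _ Lcvg)// /phi_hat; apply: cvg_lim => //.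
have P0 := polP_gt0 Qpd x0; have /andP[c0 c1] := contraction_itv.
pose D n : R := (q%:R `^ (2 / d%:R)) ^+ n * trigG Q (it n xi).
have DP : D n @[n --> \oo] --> polP Q xi.
  have [C [e [C0 e0 CP]]] := near_one_GP Qpd.
  have cp : contraction ^+ n * pnorm Q xi @[n --> \oo] --> (0 : R).
    rewrite -[X in _ --> X](mul0r (pnorm Q xi)).
    by apply: cvgM; [apply: cvg_expr; rewrite gtr0_norm|exact: cvg_cst].
  have DE n : D n = polP Q xi * (trigG Q (it n xi) / polP Q (it n xi)).
    rewrite /D -(pnorm_sqr Qpd (it n xi)) pnorm_iter exprMn pnorm_sqr//.
    have -> : (q%:R `^ (2 / d%:R)) ^+ n = (contraction ^+ n ^+ 2)^-1 :> R.
      apply: (mulIf (expf_neq0 2 (expf_neq0 n (lt0r_neq0 c0)))).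
      rewrite mulVf ?expf_neq0 ?lt0r_neq0// exprAC -exprMn.
      by rewrite contraction_sqr expr1n.
    have cn0 : contraction ^+ n != 0 by rewrite expf_neq0// lt0r_neq0.
    by field; rewrite cn0 gt_eqF.
  have -> : D = fun n => polP Q xi * (trigG Q (it n xi) / polP Q (it n xi)).
    exact/funext.
  rewrite -[X in _ --> X]mulr1; apply: cvgM; first exact: cvg_cst.
  have cC : C * (contraction ^+ n * pnorm Q xi) @[n --> \oo] --> (0 : R).
    by rewrite -[X in _ --> X](mulr0 C); apply: cvgM => //; exact: cvg_cst.
  apply/cvgrPdist_le => eps eps0; near=> n.
  have pe : pnorm Q (it n xi) <= e.
    rewrite pnorm_iter (le_trans (ler_norm _))// -[X in `|X|]subr0 distrC.
    by near: n; move/cvgrPdist_le: cp; exact.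
  rewrite distrC (le_trans (CP _ (iter_neq0 n x0) pe))// pnorm_iter.
  rewrite (le_trans (ler_norm _))// -[X in `|X|]subr0 distrC.
  by near: n; move/cvgrPdist_le: cC; exact.
have lim1 : (\prod_(j < n) mu A Q (it j xi)) * trigG Q xi * (D n)^-1
    @[n --> \oo] --> L * trigG Q xi * (polP Q xi)^-1.
  apply: cvgM; first by apply: cvgM => //; exact: cvg_cst.
  by apply: cvgV => //; rewrite gt_eqF.
have -> : trigG Q xi * (L / polP Q xi) = L * trigG Q xi * (polP Q xi)^-1.
  by rewrite mulrA [_ * L]mulrC.
apply: cvg_trans lim1; apply: near_eq_cvg; near=> n.
have D0 : D n != 0.
  by rewrite gt_eqF//; near: n; exact: (cvgr_gt _ DP).
by rewrite -mask_prod_telescope mulfK.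
Unshelve. all: by end_near. Qed.

End Dilation.

(** * The trigonometric form is a trigonometric polynomial *)

Section TrigPoly.
Context {R : realType} {d : nat}.
Implicit Types (f g : 'cV[R]_d -> R[i]) (xi : 'cV[R]_d).

Definition is_trig_poly f := exists c, f = trig_poly c.

Lemma trig_poly_cst (a : R[i]) : is_trig_poly (fun=> a).
Proof.
exists [:: (0, a)]; apply/funext => xi; rewrite /trig_poly big_seq1 /=.
rewrite (_ : dot _ _ = 0) ?cis0 ?mulr1// /dot big1// => i _.
by rewrite !mxE mul0r.
Qed.

Lemma trig_poly_cis k : is_trig_poly (fun xi => cis (dot (map_mx intr k) xi)).
Proof.
by exists [:: (k, 1)]; apply/funext => xi; rewrite /trig_poly big_seq1 /= mul1r.
Qed.

Lemma trig_polyD f g : is_trig_poly f -> is_trig_poly g ->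
  is_trig_poly (fun xi => f xi + g xi).
Proof.
move=> [c ->] [c' ->]; exists (c ++ c'); apply/funext => xi.
by rewrite /trig_poly big_cat.
Qed.

Lemma trig_polyM f g : is_trig_poly f -> is_trig_poly g ->
  is_trig_poly (fun xi => f xi * g xi).
Proof.
move=> [c ->] [c' ->].
exists [seq (a.1 + b.1, a.2 * b.2) | a <- c, b <- c']; apply/funext => xi.
rewrite /trig_poly mulr_suml big_allpairs_dep; apply: eq_bigr => a _.
rewrite mulr_sumr; apply: eq_bigr => b _ /=.
rewrite mulrACA -cisD; congr (_ * cis _).
by rewrite /dot -big_split; apply: eq_bigr => i _; rewrite /= -mulrDl !mxE intrD.
Qed.

Lemma trig_polyX f m : is_trig_poly f -> is_trig_poly (fun xi => f xi ^+ m).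
Proof.
move=> tf; elim: m => [|m IHm]; first exact: trig_poly_cst.
by under eq_fun do rewrite exprS; exact: trig_polyM.
Qed.

(** Euler's formulas. *)
Lemma trig_poly_coord (i : 'I_d) :
  is_trig_poly (fun xi => (cos (xi i 0))%:C) /\
  is_trig_poly (fun xi => (sin (xi i 0))%:C).
Proof.
have dotE (e : int) xi : dot (map_mx intr (e *: delta_mx i 0)) xi =
    e%:~R * xi i 0.
  rewrite /dot (bigD1 i)//= big1 => [|j ji]; last first.
    by rewrite !mxE eqxx andbT (negbTE ji) mulr0 mul0r.
  by rewrite !mxE !eqxx mulr1 addr0.
have tp : is_trig_poly (fun xi => cis (xi i 0)).
  have := trig_poly_cis (1 *: delta_mx i 0).
  by under eq_fun do rewrite dotE mul1r.
have tm : is_trig_poly (fun xi => cis (- xi i 0)).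
  have := trig_poly_cis ((- 1) *: delta_mx i 0).
  by under eq_fun do rewrite dotE mulN1r.
split.
  have := trig_polyM (trig_poly_cst (2^-1)%:C) (trig_polyD tp tm).
  congr is_trig_poly; apply/funext => xi; rewrite /cis cosN sinN.
  by apply/eqP; rewrite eq_complex /=; apply/andP; split; apply/eqP; field.
have := trig_polyM (trig_poly_cst (0 -i* 2^-1))
  (trig_polyD tp (trig_polyM (trig_poly_cst (-1)%:C) tm)).
congr is_trig_poly; apply/funext => xi; rewrite /cis cosN sinN.
by apply/eqP; rewrite eq_complex /=; apply/andP; split; apply/eqP; field.
Qed.

Definition is_real_trig_poly (f : 'cV[R]_d -> R) :=
  is_trig_poly (fun xi => (f xi)%:C).

Lemma real_trig_polyD (f g : 'cV[R]_d -> R) : is_real_trig_poly f ->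
  is_real_trig_poly g -> is_real_trig_poly (fun xi => f xi + g xi).
Proof.
move=> tf tg; have := trig_polyD tf tg.
by congr is_trig_poly; apply/funext => xi; rewrite -rmorphD.
Qed.

Lemma real_trig_polyM (f g : 'cV[R]_d -> R) : is_real_trig_poly f ->
  is_real_trig_poly g -> is_real_trig_poly (fun xi => f xi * g xi).
Proof.
move=> tf tg; have := trig_polyM tf tg.
by congr is_trig_poly; apply/funext => xi; rewrite -rmorphM.
Qed.

Lemma real_trig_poly_cst (a : R) : is_real_trig_poly (fun=> a).
Proof. exact: trig_poly_cst. Qed.

Lemma real_trig_poly_sum (T : Type) (s : seq T) (P : pred T)
    (F : T -> 'cV[R]_d -> R) : (forall t, is_real_trig_poly (F t)) ->
  is_real_trig_poly (fun xi => \sum_(t <- s | P t) F t xi).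
Proof.
move=> tF; elim: s => [|t s IHs].
  rewrite (_ : (fun xi => _) = fun=> 0); first exact: real_trig_poly_cst.
  by apply/funext => xi; rewrite big_nil.
rewrite (_ : (fun xi => _) = fun xi => if P t then
    F t xi + \sum_(t <- s | P t) F t xi else \sum_(t <- s | P t) F t xi).
  by case: (P t) => //; exact: real_trig_polyD.
by apply/funext => xi; rewrite big_cons.
Qed.

(** Half angles are removed by 4 sin^2(t/2) = 2 - 2 cos t. *)
Lemma trig_poly_trigG (Q : 'M[R]_d) : is_real_trig_poly (trigG Q).
Proof.
have -> : trigG Q = fun xi => \sum_i (Q *m Q) i i * (2 + -2 * cos (xi i 0)) +
    2 * (\sum_(i < d) \sum_(j < d | (i < j)%N)
      (Q *m Q) i j * (sin (xi i 0) * sin (xi j 0))).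
  apply/funext => xi; rewrite trigGE mulr_sumr; congr (_ + _).
  by apply: eq_bigr => i _; rewrite mulrCA cos_half mulNr.
apply: real_trig_polyD.
  apply: real_trig_poly_sum => i; apply: real_trig_polyM.
    exact: real_trig_poly_cst.
  apply: real_trig_polyD; first exact: real_trig_poly_cst.
  apply: real_trig_polyM; first exact: real_trig_poly_cst.
  by have [] := trig_poly_coord i.
apply: real_trig_polyM; first exact: real_trig_poly_cst.
apply: real_trig_poly_sum => i; apply: real_trig_poly_sum => j.
apply: real_trig_polyM; first exact: real_trig_poly_cst.
by apply: real_trig_polyM; [have [] := trig_poly_coord i|have [] := trig_poly_coord j].
Qed.

End TrigPoly.

Theorem proposition4p3 (R : realType) (d : nat) (hd : (0 < d)%N)
    (A : 'M[int]_d) (hA : isotropic_dilation (R := R) A)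
    (Q : 'M[R]_d) (hQ : factors A Q) (m : nat) (hm : (1 <= m)%N) :
  (forall rho_hat : 'cV[R]_d -> R[i],
     ((forall xi, xi != 0 ->
         (laplacian_symbol A Q xi)%:C ^+ m * rho_hat xi = 1) <->
      (forall xi, xi != 0 ->
         rho_hat xi = (prodM A Q xi / polP Q xi)%:C ^+ m)) /\
     ((forall xi, xi != 0 ->
         (laplacian_symbol A Q xi)%:C ^+ m * rho_hat xi = 1) ->
      exists c : seq ('cV[int]_d * R[i]),
        forall xi, xi != 0 ->
          phi_hat_pow A Q m xi = trig_poly c xi * rho_hat xi)) /\
  (forall phim : ('cV[R]_d -> R[i]) -> R[i],
     elliptic_scaling_function A Q m phim ->
     (exists g, multiplier_image (fun xi => (laplacian_symbol A Q xi)%:C ^+ m)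
                  (phi_hat_pow A Q m) phim g) /\
     forall g, multiplier_image (fun xi => (laplacian_symbol A Q xi)%:C ^+ m)
                 (phi_hat_pow A Q m) phim g ->
       vanishes_on (~` int_lattice) g).
Proof.
have [r [r_uniq rP]] := digits_seq hd hA.
have Qpd : sym_posdef Q by case: hQ.
have M0 xi : xi != 0 -> 0 < prodM A Q xi by exact: (prodM_gt0 hd hA hQ r_uniq rP).
have P0 xi : xi != 0 -> 0 < polP Q xi by exact: polP_gt0.
have phiE xi : xi != 0 -> phi_hat_pow A Q m xi =
    (trigG Q xi)%:C ^+ m * (prodM A Q xi / polP Q xi)%:C ^+ m.
  move=> x0; rewrite /phi_hat_pow (phi_hatE hd hA hQ r_uniq rP)//.
  by rewrite rmorphM exprMn.
have [c cE] := trig_polyX m (trig_poly_trigG Q).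
have symbolK xi : xi != 0 ->
    (laplacian_symbol A Q xi)%:C ^+ m * (prodM A Q xi / polP Q xi)%:C ^+ m = 1.
  move=> x0; rewrite -exprMn -rmorphM /laplacian_symbol.
  by rewrite -invf_div mulVf ?expr1n// mulf_neq0// ?invr_eq0 gt_eqF ?M0 ?P0.
have rhoE (rho_hat : 'cV[R]_d -> R[i]) xi : xi != 0 ->
    (laplacian_symbol A Q xi)%:C ^+ m * rho_hat xi = 1 ->
    rho_hat xi = (prodM A Q xi / polP Q xi)%:C ^+ m.
  move=> x0 h; rewrite -[LHS]mul1r -(symbolK xi x0).
  by rewrite mulrAC h mul1r.
split=> [rho_hat|phim phimP].
  split; first split=> h xi x0.
  - exact: rhoE (h xi x0).
  - by rewrite h// symbolK.
  move=> h; exists c => xi x0; rewrite -cE (rhoE rho_hat xi x0 (h xi x0)).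
  exact: phiE.
have imageE : (fun xi => (laplacian_symbol A Q xi)%:C ^+ m * phi_hat_pow A Q m xi)
    = trig_poly c.
  (* At the origin both sides vanish, as P and G do and m is positive. *)
  rewrite -cE; apply/funext => xi; have [->|x0] := eqVneq xi 0.
    rewrite trigG0 /laplacian_symbol.
    have /eqP -> : polP Q 0 == 0 by rewrite polP_eq0.
    by rewrite mul0r expr0n; case: (m) hm => // n _; rewrite mul0r.
  by rewrite phiE// mulrCA symbolK// mulr1.
rewrite /multiplier_image imageE; split.
  by exists (comb c); split => //; exact: comb_has_fourier.
by move=> g [_]; exact: trig_poly_vanishes.
Qed.
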